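(* Let $G$ be a finite undirected graph without loops or parallel edges. Then $G$ is pure if and only if $G$ is outerplanar. Equivalently, for any orientation $\vec G$ of $G$, the graphical oriented matroid $\mathcal M_{\vec G}$ is pure if and only if $G$ is outerplanar.
   Context: Two total orientations $O_1,O_2$ of $G$ are $G$-separated if there is no cycle $C$ of $G$ that is a directed cycle in both $O_1$ and $O_2$ but with opposite directions. $G$ is pure if every collection of pairwise $G$-separated total orientations of $G$ that is maximal by inclusion has cardinality equal to the number of forests (acyclic edge subsets) of $G$. For a directed graph $\vec G$ on vertex set $[d]$, $\mathcal M_{\vec G}$ is the oriented matroid of linear dependencies of the vectors $e_i-e_j\in\mathbb R^d$ over the edges $i\to j$ (circuits = sign patterns of minimal linear dependencies). An oriented matroid $\mathcal M$ is pure if every $\mathcal M$-separated collection maximal by inclusion has maximum cardinality, where $I,J$ are $\mathcal M$-separated if no circuit $X$ satisfies $X^+\subseteq I\setminus J$, $X^-\subseteq J\setminus I$. A graph is outerplanar if it can be drawn in the plane without crossings with every vertex on the outer face (equivalently, it has no $K_4$ or $K_{2,3}$ minor). *)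

(* Defs.v *)
From HB Require Import structures.
From mathcomp Require Import all_boot all_order all_algebra.
Set Implicit Arguments. Unset Strict Implicit. Unset Printing Implicit Defensive.
Import Order.TTheory GRing.Theory Num.Theory.

(* A finite simple graph is a symmetric irreflexive relation e on a finType T.
   Vertices: T; edges: unordered pairs {x,y} with e x y. *)

Section Graphs.
Variables (T : finType) (e : rel T).

Definition total_orientation (O : {set T * T}) : Prop :=
  (forall p, p \in O -> e p.1 p.2) /\
  (forall x y, e x y -> ((x, y) \in O) != ((y, x) \in O)).

Definition graph_cycle (c : seq T) : bool :=
  [&& uniq c, 2 < size c & cycle e c].

Definition G_separated (O1 O2 : {set T * T}) : Prop :=
  ~ exists c : seq T,
      [/\ graph_cycle c,
          cycle (fun x y => (x, y) \in O1) c &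
          cycle (fun x y => (y, x) \in O2) c].

Definition G_separated_collection (S : {set {set T * T}}) : Prop :=
  (forall O, O \in S -> total_orientation O) /\
  (forall O1 O2, O1 \in S -> O2 \in S -> G_separated O1 O2).

Definition G_maximal_separated (S : {set {set T * T}}) : Prop :=
  G_separated_collection S /\
  forall O, total_orientation O -> O \notin S ->
    ~ G_separated_collection (O |: S).

Definition graph_edges : {set {set T}} :=
  [set E : {set T} | [exists x, exists y, e x y && (E == [set x; y])]].

Definition forest (F : {set {set T}}) : Prop :=
  F \subset graph_edges /\
  ~ exists c : seq T,
      [&& uniq c, 2 < size c & cycle (fun x y => [set x; y] \in F) c].

Definition is_num_forests (n : nat) : Prop :=
  exists s : seq {set {set T}},
    [/\ uniq s, size s = n & forall F, F \in s <-> forest F].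

Definition pure_graph : Prop :=
  forall S, G_maximal_separated S -> is_num_forests #|S|.

Definition induced (B : {set T}) : rel T :=
  fun x y => [&& e x y, x \in B & y \in B].

Definition has_minor (U : finType) (h : rel U) : Prop :=
  exists f : U -> {set T},
    [/\ forall u, f u != set0,
        forall u v, u != v -> [disjoint f u & f v],
        forall u x y, x \in f u -> y \in f u -> connect (induced (f u)) x y &
        forall u v, h u v -> exists x y, [/\ x \in f u, y \in f v & e x y]].

End Graphs.

Definition K4_rel : rel 'I_4 := fun i j => i != j.

Definition K23_rel : rel ('I_2 + 'I_3)%type :=
  fun a b => match a, b with
             | inl _, inr _ | inr _, inl _ => true
             | _, _ => false
             end.

Definition outerplanar (T : finType) (e : rel T) : Prop :=
  ~ has_minor e K4_rel /\ ~ has_minor e K23_rel.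

(* Graphical oriented matroid of a digraph D (set of arcs on vertex set T),
   realized by the vectors e_i - e_j in R^T for arcs (i,j), over an ordered
   field R. Ground set: the arcs of D. *)
Section OrientedMatroid.
Variables (R : realFieldType) (T : finType) (D : {set T * T}).

(* lam is a linear dependency of the vectors e_{a.1} - e_{a.2}, a \in D. *)
Definition lin_dependency (lam : T * T -> R) : Prop :=
  (forall a, a \notin D -> lam a = 0%R) /\
  forall v : T,
    (\sum_(a in D) lam a * ((a.1 == v)%:R - (a.2 == v)%:R) = 0)%R.

Definition dep_support (lam : T * T -> R) : {set T * T} :=
  [set a in D | lam a != 0%R].

Definition minimal_dependency (lam : T * T -> R) : Prop :=
  [/\ lin_dependency lam, dep_support lam != set0 &
      forall mu, lin_dependency mu -> dep_support mu != set0 ->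
        ~ (dep_support mu \proper dep_support lam)].

Definition om_circuit (Xp Xm : {set T * T}) : Prop :=
  exists lam, minimal_dependency lam /\
    Xp = [set a in D | (0 < lam a)%R] /\ Xm = [set a in D | (lam a < 0)%R].

Definition M_separated (I J : {set T * T}) : Prop :=
  ~ exists Xp Xm, [/\ om_circuit Xp Xm, Xp \subset I :\: J & Xm \subset J :\: I].

Definition M_separated_collection (S : {set {set T * T}}) : Prop :=
  (forall I : {set T * T}, I \in S -> I \subset D) /\
  (forall I J : {set T * T}, I \in S -> J \in S -> M_separated I J).

Definition M_maximal_separated (S : {set {set T * T}}) : Prop :=
  M_separated_collection S /\
  forall I : {set T * T}, I \subset D -> I \notin S -> ~ M_separated_collection (I |: S).

Definition om_pure : Prop :=
  forall S S', M_maximal_separated S -> M_separated_collection S' ->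
    #|S'| <= #|S|.

End OrientedMatroid.

(* Main.v *)
Require Import Defs.
From HB Require Import structures.
From mathcomp Require Import all_boot all_order all_algebra zify.
Set Implicit Arguments. Unset Strict Implicit. Unset Printing Implicit Defensive.

(* Two orientations O1, O2 are separated exactly when the digraph of the arcs lying in O1 and
   reversed in O2 is acyclic.  A separated family shatters only forests, so by Pajor's lemma it has
   at most as many members as there are forests, and in the case of equality it contains, for
   every forest F, all reorientations along F of some orientation.  The bound is attained by the
   orientations in which every directed cycle follows a reference orientation on its edge of
   largest rank.

   If G has a K_4 or K_{2,3} minor, a few orientations of the minor, lifted to G with all orientations
   of spanning trees of the branch sets, form a separated family such that no orientation can be
   reoriented arbitrarily along a certain forest without conflicting with it; a maximal family
   containing it is therefore too small.

   If G is outerplanar and has an edge, it has a vertex v of degree 1 or 2, and one deletes it,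
   adding the edge ab between its two neighbours if there are two and it is missing.  The key
   point is that, writing k(O, O') for the existence of a path from b to a directed in O and
   reversed in O', the relation k is transitive on separated triples, because G has no K_{2,3}
   minor.  This makes the restrictions of a maximal family maximal again, and the sizes of all
   maximal families are then determined by induction. *)

(** * Maximal families and parallel extensions *)

(** Separation is a property of pairs, so the counting is done for a bare compatibility relation on
    a finite set, and [equisized] only asks that all maximal families have one size. The induction
    never identifies this size with a number of forests; the family governed by edges of largest
    rank, extended to a maximal one, does so afterwards. The obstacle is that the induction leaves
    the simple graphs: suppressing a vertex of degree two whose neighbours [a] and [b] are already
    adjacent doubles the edge [ab]. The rest of the graph is therefore remembered only through the
    relation [k], which is all that a new connection between [a] and [b] can see, and the doubled
    edge is counted by inclusion and exclusion over zero, one and two copies of it. Intersecting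
    with a fixed orientation [D] turns orientations into subsets of [D]. This makes extremal set
    theory applicable, and the same dictionary carries the statement on oriented matroids over to
    graphs. *)

Section MaximalFamilies.
Variable X : finType.
Implicit Types (C S : {set X}) (s : rel X).

Definition maximal_family C s S : Prop :=
  [/\ S \subset C, {in S &, forall o o', s o o'} &
      forall o, o \in C -> {in S, forall o', s o o'} -> o \in S].

Definition equisized C s n := forall S, maximal_family C s S -> #|S| = n.

Lemma extend_family C s S :
  {in C, reflexive s} -> symmetric s -> S \subset C -> {in S &, forall o o', s o o'} ->
  exists2 S' : {set X}, S \subset S' & maximal_family C s S'.
Proof.
move=> srefl ssym SC Ss.
pose P := fun (S' : {set X}) =>
  [&& S' \subset C, S \subset S' & [forall o in S', forall o' in S', s o o']].
have PS : P S.
  by rewrite /P SC subxx; apply/forall_inP => o oS; apply/forall_inP => o'; apply: Ss.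
have [S' /maxsetP[/and3P[S'C SS' S's] mS'] _] := maxset_exists PS.
have S's' : {in S' &, forall o o', s o o'}.
  by move=> o o' oS o'S; apply: (forall_inP (forall_inP S's _ oS)).
exists S' => //; split => // o oC os.
rewrite -(mS' (o |: S')) ?setU11 ?subsetUr //; apply/and3P; split.
- by rewrite subUset sub1set oC.
- by rewrite (subset_trans SS') ?subsetUr.
apply/forall_inP => x /setU1P xo; apply/forall_inP => y /setU1P yo.
case: xo yo => [->|xS] [->|yS]; [exact: srefl|exact: os|rewrite ssym; exact: os|exact: S's'].
Qed.
End MaximalFamilies.

Section Transfer.
Variables (X Y : finType) (h : Y -> X) (C : {set Y}) (sY : rel Y) (sX : rel X).
Hypothesis h_inj : {in C &, injective h}.
Hypothesis h_rel : {in C &, forall y y', sX (h y) (h y') = sY y y'}.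

Lemma equisized_image n : equisized C sY n <-> equisized (h @: C) sX n.
Proof.
split=> pC S [SC Ss Smax].
- have ES : S = h @: [set y in C | h y \in S].
    apply/setP=> x; apply/idP/imsetP => [xS|[y]].
      have /imsetP[y yC xE] := subsetP SC _ xS.
      by exists y => //; rewrite inE yC -xE.
    by rewrite inE => /andP[_ ?] ->.
  rewrite ES card_in_imset; last first.
    by move=> y y'; rewrite !inE => /andP[yC _] /andP[y'C _]; apply: h_inj.
  apply: pC; split.
  + by apply/subsetP => y; rewrite inE => /andP[].
  + by move=> y y'; rewrite !inE => /andP[yC yS] /andP[y'C y'S]; rewrite -h_rel // Ss.
  + move=> y yC ys; rewrite inE yC; apply: Smax => [|x xS]; first exact: imset_f.
    have /imsetP[y' y'C xE] := subsetP SC _ xS.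
    by rewrite xE h_rel // ys // inE y'C -xE.
- have iS : {in S &, injective h} by move=> ? ? /(subsetP SC) ? /(subsetP SC) ?; apply: h_inj.
  rewrite -(card_in_imset iS); apply: pC; split.
  + exact: imsetS.
  + move=> _ _ /imsetP[y yS ->] /imsetP[y' y'S ->].
    by rewrite h_rel ?Ss // (subsetP SC).
  + move=> _ /imsetP[y yC ->] ys; apply: imset_f; apply: Smax => // y' y'S.
    by rewrite -h_rel ?ys ?imset_f // (subsetP SC).
Qed.
End Transfer.

(* [k o o'] stands for the existence of a path from [b] to [a] that is directed in [o] and reversed
   in [o'].  [edge_rel] is separation after adding one edge between [a] and [b], oriented
   from [a] to [b] when the Boolean is [true]; [path_rel] is separation after
   adding a path [a - v - b] of length two through a new vertex. *)
Section ParallelExtension.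
Variables (X : finType) (s k : rel X).

Definition edge_rel : rel (X * bool) := fun p q =>
  [&& s p.1 q.1, p.2 && ~~ q.2 ==> ~~ k p.1 q.1 & ~~ p.2 && q.2 ==> ~~ k q.1 p.1].

(** The relation that replaces [k] once the edge is present: the second disjunct is the new edge
    itself, directed from [b] to [a] in the first orientation and reversed in the second. *)
Definition edge_conn : rel (X * bool) := fun p q => k p.1 q.1 || ~~ p.2 && q.2.

Definition path_rel : rel (X * (bool * bool)) := fun p q =>
  [&& s p.1 q.1,
      (p.2 == (true, true)) && (q.2 == (false, false)) ==> ~~ k p.1 q.1 &
      (p.2 == (false, false)) && (q.2 == (true, true)) ==> ~~ k q.1 p.1].

Definition transitive_conn (C : {set X}) :=
  forall o o' o'', o \in C -> o' \in C -> o'' \in C ->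
    s o o' -> s o o'' -> s o'' o' -> k o o' -> k o'' o -> k o'' o'.
End ParallelExtension.

Section EdgeExtension.
Variables (X : finType) (s k : rel X) (C : {set X}).
Hypothesis k_tr : transitive_conn s k C.

Let C1 := setX C [set: bool].

(** Suppose [o] fits the projection but neither [(o, true)] nor [(o, false)] can be added. The first
    is blocked by some [(o', false)] with [k o o'], the second by some [(o'', true)] with [k o'' o].
    Transitivity gives [k o'' o'], so these two members of [A] would be incompatible. *)
Lemma edge_rel_proj (A : {set X * bool}) :
  maximal_family C1 (edge_rel s k) A -> maximal_family C s (fst @: A).
Proof.
move=> [AC As Amax]; split.
- by apply/subsetP => _ /imsetP[p /(subsetP AC) + ->]; rewrite inE => /andP[].
- by move=> _ _ /imsetP[p pA ->] /imsetP[q qA ->]; have /and3P[] := As _ _ pA qA.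
move=> o oC os.
have os' x o' : (o', x) \in A -> s o o' by move=> oA; apply: os; apply/imsetP; exists (o', x).
have memA o' x : (o', x) \in A -> o' \in C.
  by move/(subsetP AC); rewrite inE => /andP[].
have [|/forall_inPn[[o' x'] oA' kt]] := boolP [forall p in A, edge_rel s k (o, true) p].
  move/forall_inP => ct; apply/imsetP; exists (o, true) => //; apply: Amax => //.
  by rewrite !inE oC.
have [|/forall_inPn[[o'' x''] oA'' kf]] := boolP [forall p in A, edge_rel s k (o, false) p].
  move/forall_inP => ct; apply/imsetP; exists (o, false) => //; apply: Amax => //.
  by rewrite !inE oC.
move: kt kf; rewrite /edge_rel /= !(os' _ _ oA') !(os' _ _ oA'') /= ?implybF ?implybT.
case: x' oA' => oA'; rewrite //= andbT negbK => kt.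
case: x'' oA'' => oA''; rewrite //= negbK => kf.
have := As _ _ oA'' oA'; rewrite /edge_rel /= => /and3P[s3 /negP[]].
by apply: (k_tr oC) => //; [exact: memA oA'|exact: memA oA''|exact: os' oA'|exact: os' oA''].
Qed.

(** Since transitivity survives the new edge, the projection argument can be repeated for a second
    edge between [a] and [b]. *)
Lemma edge_conn_tr : transitive_conn (edge_rel s k) (edge_conn k) C1.
Proof.
move=> [o x] [o' x'] [o'' x'']; rewrite !in_setX /= !in_setT !andbT => oC oC' oC''.
rewrite /edge_rel /edge_conn /= => /and3P[s1 a1 b1] /and3P[s2 a2 b2] /and3P[s3 a3 b3].
case/orP=> [k1|/andP[nx xx']].
  case/orP=> [k2|/andP[nx xx']]; first by rewrite (k_tr oC oC' oC'').
  by rewrite nx; case: x' a1 b1 a3 b3; rewrite ?orbT //= xx' k1.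
case/orP=> [k2|/andP[nx2 xx2]]; last by rewrite xx2 in nx.
by rewrite xx'; case: x'' a2 b2 a3 b3; rewrite ?orbT //= nx k2.
Qed.
End EdgeExtension.

Lemma sum_pair_bool (X : finType) (F : X * bool -> nat) :
  \sum_p F p = \sum_o (F (o, true) + F (o, false)).
Proof.
rewrite (eq_bigr (fun p => F (p.1, p.2))) => [|[]//].
rewrite -(pair_big xpredT xpredT (fun o x => F (o, x))) /=.
by apply: eq_bigr => o _; rewrite big_bool.
Qed.

Lemma card_pair_bool (X : finType) (S : {set X * bool}) :
  #|S| = \sum_(o : X) (((o, true) \in S) + ((o, false) \in S)).
Proof.
rewrite -(sum_pair_bool (fun p => nat_of_bool (p \in S))) -sum1_card big_mkcond.
by apply: eq_bigr => p _; case: (p \in S).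
Qed.

Lemma mem_fst_bool (X : finType) (S : {set X * bool}) o :
  (o \in fst @: S) = ((o, true) \in S) || ((o, false) \in S).
Proof.
apply/imsetP/orP => [[[o' []] pS /= ->]|[] oS]; [by left|by right|..];
by [exists (o, true)|exists (o, false)].
Qed.

Section Parallel.
Variables (X : finType) (s k : rel X) (C : {set X}) (n0 n1 : nat).
Hypothesis k_tr : transitive_conn s k C.
Let C1 := setX C [set: bool].
Hypothesis equi0 : equisized C s n0.
Hypothesis equi1 : equisized C1 (edge_rel s k) n1.

Let s2 := edge_rel (edge_rel s k) (edge_conn k).
Let swap (p : X * bool * bool) := (p.1.1, p.2, p.1.2).

Let swapK : involutive swap. Proof. by case=> [[]]. Qed.

(** The two parallel edges play the same part, so either of them can be forgotten first. *)
Let s2_swap p q : s2 (swap p) (swap q) = s2 p q.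
Proof.
case: p q => [[o x] y] [[o' x'] y']; rewrite /s2 /edge_rel /edge_conn /swap /=.
by case: (s o o') (k o o') (k o' o) => [] [] []; case: x x' y y' => [] [] [] [].
Qed.

(** Over each [o] of the projection the fibre is a nonempty set of pairs of Booleans, and the claim
    is that its size plus one is the sum of the sizes of its two coordinate projections. This fails
    only for the diagonal, the antidiagonal and the full square, which [fill] and [cross]
    exclude. *)
Lemma card_parallel S : maximal_family (setX C1 [set: bool]) s2 S -> #|S| + n0 = n1 + n1.
Proof.
move=> maxS; have maxA := edge_rel_proj (edge_conn_tr k_tr) maxS.
have maxS' : maximal_family (setX C1 [set: bool]) s2 (swap @: S).
  case: maxS => SC Ss Smax.
  have swapC p : (swap p \in setX C1 [set: bool]) = (p \in setX C1 [set: bool]).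
    by case: p => [[o x] y]; rewrite !in_setX !in_setT.
  split.
  - by apply/subsetP => _ /imsetP[p pS ->]; rewrite swapC (subsetP SC).
  - by move=> _ _ /imsetP[p pS ->] /imsetP[q qS ->]; rewrite s2_swap Ss.
  move=> p pC ps; rewrite -(swapK p) imset_f //; apply: Smax; first by rewrite swapC.
  by move=> q qS; rewrite -s2_swap swapK ps ?imset_f.
have maxA' := edge_rel_proj (edge_conn_tr k_tr) maxS'.
rewrite -{1}(equi1 maxA) -(equi1 maxA') -(equi0 (edge_rel_proj k_tr maxA)).
have swapS o x y : ((o, x, y) \in swap @: S) = ((o, y, x) \in S).
  rewrite -[(o, x, y)]/(swap (o, y, x)) mem_imset //.
  exact: can_inj swapK.
rewrite 3!card_pair_bool sum_pair_bool -sum1_card [X in _ + X]big_mkcond -!big_split /=.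
apply: eq_bigr => o _; rewrite !mem_fst_bool !swapS.
case: maxS => SC Ss Smax.
(* The two copies of the edge alone form a directed cycle of length two here. *)
have cross u v : (u, true, false) \in S -> (v, false, true) \in S -> False.
  by move=> uS vS; have := Ss _ _ uS vS; rewrite /s2 /edge_rel /edge_conn /= orbT !andbF.
(* Whatever is compatible with both constant lifts of [o] is compatible with a mixed lift of [o],
   unless it is itself mixed in the opposite way. By [cross] only one mixed kind occurs in [S], so
   the mixed lift of that kind can be added. *)
have fill : (o, true, true) \in S -> (o, false, false) \in S ->
    ((o, true, false) \in S) || ((o, false, true) \in S).
  move=> ott off.
  have oC x y : (o, x, y) \in setX C1 [set: bool].
    by have := subsetP SC _ ott; rewrite !in_setX !in_setT.
  have comp x y o' x' y' : (o', x', y') \in S ->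
      ~~ (x && ~~ y && ~~ x' && y') -> ~~ (~~ x && y && x' && ~~ y') -> s2 (o, x, y) (o', x', y').
    move=> oS'; have := Ss _ _ ott oS'; have := Ss _ _ off oS'.
    rewrite /s2 /edge_rel /edge_conn /=.
    by move=> {oS'}; case: (s o o') (k o o') (k o' o) => [] [] []; case: x x' y y' => [] [] [] [].
  have [/existsP[u uS]|/existsPn nS] := boolP [exists u, (u, true, false) \in S].
    rewrite (Smax (o, true, false)) ?oC // => -[[o2 x2] y2] oS2; apply: (comp _ _ _ _ _ oS2) => //.
    by case: x2 y2 oS2 => [] [] // /(cross u o2 uS).
  rewrite orbC (Smax (o, false, true)) ?oC // => -[[o2 x2] y2] oS2; apply: (comp _ _ _ _ _ oS2) => //.
  by case: x2 y2 oS2 => [] [] // oS2; have := nS o2; rewrite oS2.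
move: fill (@cross o o).
case: ((o, true, true) \in S); case: ((o, true, false) \in S);
case: ((o, false, true) \in S); case: ((o, false, false) \in S) => //= f c.
all: by [case: (c isT isT) | have := f isT isT].
Qed.
End Parallel.

Section PathExtension.
Variables (X : finType) (s k : rel X) (C : {set X}) (n m : nat).
Hypothesis k_tr : transitive_conn s k C.
Hypothesis equi0 : equisized C s n.
Hypothesis equi1 : equisized (setX C [set: bool]) (edge_rel s k) m.

(** If the two new edges do not form a directed path, they impose no condition, so both such lifts
    of every projected [o] are present; they account for [n + n]. The lifts in which the path is
    directed behave like a single edge and account for [m]. *)
Lemma equisized_path : equisized (setX C [set: bool * bool]) (path_rel s k) (n + n + m).
Proof.
move=> S [SC Ss Smax].
have SC' o t : (o, t) \in S -> o \in C by move/(subsetP SC); rewrite in_setX => /andP[].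
pose A := fst @: S; pose E := [set p : X * bool | (p.1, (p.2, p.2)) \in S].
have mixed o y : ((o, (y, ~~ y)) \in S) = (o \in A).
  apply/idP/idP => [oS|/imsetP[[o1 t] oS /= ->]]; first by apply/imsetP; exists (o, (y, ~~ y)).
  apply: Smax; first by rewrite in_setX in_setT (SC' _ _ oS).
  by move=> [o' t'] oS'; have /and3P[so _ _] := Ss _ _ oS oS'; rewrite /path_rel /= so; case: y.
have maxA : maximal_family C s A.
  split.
  - by apply/subsetP => _ /imsetP[[o t] oS ->]; exact: SC' oS.
  - by move=> _ _ /imsetP[p pS ->] /imsetP[q qS ->]; have /and3P[] := Ss _ _ pS qS.
  move=> o oC os; rewrite -(mixed o true) Smax //= ?in_setX ?oC ?in_setT // => -[o' t'] oS'.
  by rewrite /path_rel /= os //; apply/imsetP; exists (o', t').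
have As : {in A &, forall o o', s o o'} by case: maxA.
have AC : A \subset C by case: maxA.
have memE o y : ((o, y) \in E) = ((o, (y, y)) \in S) by rewrite inE.
have EA o y : (o, y) \in E -> o \in A by rewrite memE => oS; apply/imsetP; exists (o, (y, y)).
have pathE o y o' y' : path_rel s k (o, (y, y)) (o', (y', y')) = edge_rel s k (o, y) (o', y').
  by rewrite /path_rel /edge_rel /=; case: y y' => [] [].
have addE o y : o \in A -> {in E, forall p, edge_rel s k (o, y) p} -> (o, y) \in E.
  move=> oA oE; rewrite memE; apply: Smax; first by rewrite in_setX in_setT (subsetP AC).
  move=> [o' [y' z']] oS'; have oA' : o' \in A by apply/imsetP; exists (o', (y', z')).
  have [yz|yz] := eqVneq y' z'; first by move: oS'; rewrite -yz => oS'; rewrite pathE oE // memE.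
  by rewrite /path_rel /= As //; case: y' z' yz oS' => [] [] //; case: (y).
(* Every member of [A] has a directed lift, by the argument of [edge_rel_proj]. Hence compatibility
   with [E] forces compatibility with all of [A], which the maximality of [E] requires. *)
have coverE o : o \in A -> ((o, true) \in E) || ((o, false) \in E).
  move=> oA; have oC := subsetP AC _ oA.
  have [/forall_inP/(addE _ _ oA)->//|/forall_inPn[[o' x'] oE' kt]] :=
    boolP [forall p in E, edge_rel s k (o, true) p].
  have [/forall_inP/(addE _ _ oA)->//|/forall_inPn[[o'' x''] oE'' kf]] :=
    boolP [forall p in E, edge_rel s k (o, false) p]; first by rewrite orbT.
  have [oA' oA''] := (EA _ _ oE', EA _ _ oE'').
  move: kt kf; rewrite /edge_rel /= !As //= ?implybF ?implybT.
  case: x' oE' => oE'; rewrite //= andbT negbK => kt.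
  case: x'' oE'' => oE''; rewrite //= negbK => kf.
  have := Ss (o'', (true, true)) (o', (false, false)).
  rewrite -!memE => /(_ oE'' oE'); rewrite pathE /edge_rel /= andbT => /andP[_ /negP[]].
  by apply: (k_tr oC) => //; rewrite ?As ?(subsetP AC).
have maxE : maximal_family (setX C [set: bool]) (edge_rel s k) E.
  split.
  - by apply/subsetP => -[o y] /EA oA; rewrite in_setX in_setT (subsetP AC).
  - by move=> [o y] [o' y']; rewrite !memE -pathE; exact: Ss.
  move=> [o y]; rewrite in_setX in_setT andbT /= => oC oE; apply: addE => //.
  case: maxA => _ _; apply=> // o' /coverE/orP[] /oE; by rewrite /edge_rel /= => /and3P[].
have -> : #|S| = \sum_o \sum_(t : bool * bool) nat_of_bool ((o, t) \in S).
  rewrite -sum1_card big_mkcond pair_big; apply: eq_bigr => -[o t] _ /=.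
  by case: (_ \in S).
rewrite -(equi1 maxE) -{1 2}(equi0 maxA) card_pair_bool -sum1_card -!big_split /=.
rewrite [X in X + _]big_mkcond -big_split /=; apply: eq_bigr => o _.
rewrite (sum_pair_bool (fun t => nat_of_bool ((o, t) \in S))) big_bool /=.
rewrite !memE (mixed o true) (mixed o false).
by case: (o \in A); case: (_ \in S); case: (_ \in S).
Qed.
End PathExtension.

(** * Shattering *)

Section Shattering.
Variable E : finType.
Implicit Types (S : {set {set E}}) (A B I : {set E}) (x : E).

Definition shatters S A :=
  [forall B : {set E}, (B \subset A) ==> [exists I in S, I :&: A == B]].

Definition shattered S := [set A | shatters S A].

Lemma shattersP S A :
  reflect (forall B, B \subset A -> exists2 I, I \in S & I :&: A = B) (shatters S A).
Proof.
apply: (iffP forallP) => [sh B BA|sh B].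
  have /implyP/(_ BA)/existsP[I /andP[IS /eqP]] := sh B; by exists I.
by apply/implyP => /sh[I IS IB]; apply/existsP; exists I; rewrite IS IB eqxx.
Qed.

(* With [S1] the members containing [x] and [S0] the others, a set shattered by both
   stays shattered by [S] when [x] is added. *)
Lemma card_le_shattered S : #|S| <= #|shattered S|.
Proof.
have [n] := ubnP #|S|; elim: n S => // n IH S /ltnSE Sn.
have [S1|/card_gt1P[I [J [IS JS IJ]]]] := leqP #|S| 1.
  have [->|[I IS]] := set_0Vmem S; first by rewrite cards0.
  rewrite (leq_trans S1) // card_gt0; apply/set0Pn; exists set0; rewrite inE.
  by apply/shattersP => B; rewrite subset0 => /eqP->; exists I => //; rewrite setI0.
have [x xIJ] : exists x, (x \in I) != (x \in J).
  apply/existsP; apply: contraR IJ => /existsPn eqIJ.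
  by apply/eqP/setP => x; have := eqIJ x; rewrite negbK => /eqP.
pose S1 := [set K in S | x \in K]; pose S0 := [set K in S | x \notin K].
have cS : #|S| = #|S1| + #|S0|.
  rewrite -(cardsID [set K : {set E} | x \in K] S).
  by congr (_ + _); apply: eq_card => K; rewrite !inE // andbC.
have S1_gt0 : 0 < #|S1|.
  by rewrite card_gt0; apply/set0Pn; case: (boolP (x \in I)) xIJ => xI xJ;
    [exists I|exists J]; rewrite inE ?IS ?JS //; case: (x \in J) xJ.
have S0_gt0 : 0 < #|S0|.
  by rewrite card_gt0; apply/set0Pn; case: (boolP (x \in I)) xIJ => xI xJ;
    [exists J|exists I]; rewrite inE ?IS ?JS //; case: (x \in J) xJ.
have nx A : A \in shattered S1 :|: shattered S0 -> x \notin A.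
  rewrite !inE => /orP[] /shattersP sh; apply/negP => xA.
    have [K] := sh set0 (sub0set _); rewrite inE => /andP[_ xK] /setP/(_ x).
    by rewrite !inE xK xA.
  have [K] := sh A (subxx _); rewrite inE => /andP[_ /negPf xK] /setP/(_ x).
  by rewrite !inE xK xA.
have sub : (shattered S1 :|: shattered S0) :|:
    [set x |: A | A in shattered S1 :&: shattered S0] \subset shattered S.
  apply/subsetP => A0 /setUP[|/imsetP[A /setIP[]]].
    rewrite !inE => /orP[] /shattersP sh; apply/shattersP => B /sh[K];
    by rewrite inE => /andP[KS _] <-; exists K.
  rewrite 2!inE => /shattersP sh1 /shattersP sh0 ->; rewrite inE.
  have xA : x \notin A by apply: nx; rewrite !inE; apply/orP; left; apply/shattersP.
  apply/shattersP => B BA.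
  have BxA : B :\ x \subset A.
    by apply/subsetP => y; rewrite !inE => /andP[yx /(subsetP BA)]; rewrite !inE (negPf yx).
  have [xB|xB] := boolP (x \in B).
    have [K] := sh1 _ BxA; rewrite inE => /andP[KS xK] KA; exists K => //.
    by rewrite setIUr KA (setIidPr _) ?sub1set // setD1K.
  have [K] := sh0 _ BxA; rewrite inE => /andP[KS xK] KA; exists K => //.
  rewrite setIUr KA; apply/setP => y; rewrite !inE.
  by have [->|_] := eqVneq y x; rewrite ?(negPf xK) ?(negPf xB) //= andbF.
rewrite cS (leq_trans _ (subset_leq_card sub)) // cardsU (_ : _ :&: [set _ | _ in _] = set0).
  rewrite cards0 subn0 card_in_imset => [|A B /setIP[A1 _] /setIP[B1 _] /setP AB]; last first.
    have xA : x \notin A by apply: nx; rewrite inE A1.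
    have xB : x \notin B by apply: nx; rewrite inE B1.
    apply/setP => y; have := AB y; rewrite !inE.
    by have [->|] := eqVneq y x; rewrite ?(negPf xA) ?(negPf xB).
  have -> : #|shattered S1 :|: shattered S0| + #|shattered S1 :&: shattered S0|
          = #|shattered S1| + #|shattered S0|.
    by rewrite cardsU subnK // (leq_trans (subset_leq_card (subsetIl _ _))) ?leq_addr.
  by apply: leq_add; apply: IH; lia.
apply/setP => A; rewrite in_set0; apply/negbTE/negP => /setIP[/nx xA /imsetP[B _ AB]].
by rewrite AB setU11 in xA.
Qed.

(** For traces of orientations this is the set of all reorientations along [A] of one fixed
    orientation, whereas plain shattering lets the part outside [A] vary with [B]. *)
Definition strongly_shatters S A :=
  [exists I : {set E}, [forall B : {set E}, (B \subset A) ==> ((I :\: A) :|: B \in S)]].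

Lemma strongly_shattersP S A :
  reflect (exists I, forall B, B \subset A -> (I :\: A) :|: B \in S) (strongly_shatters S A).
Proof.
apply: (iffP existsP) => -[I IS]; exists I.
  by move=> B; have /forallP/(_ B)/implyP := IS.
by apply/forallP => B; apply/implyP/IS.
Qed.

(* [A] is strongly shattered by [S] iff the complement of [S] does not shatter the complement of [A]. *)
Lemma card_strongly_shattered_le S : #|[set A | strongly_shatters S A]| <= #|S|.
Proof.
have := card_le_shattered (~: S); rewrite -(leq_add2l #|S|) cardsC => leS.
rewrite -(leq_add2r #|shattered (~: S)|) (leq_trans _ leS) // -(cardsC (shattered (~: S))) addnC.
rewrite leq_add2l -(card_imset _ (can_inj (@setCK E))) subset_leq_card //.
apply/subsetP => _ /imsetP[A + ->]; rewrite !inE => /strongly_shattersP[I IS].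
apply/negP => /shattersP/(_ (I :\: A)); case; first by rewrite setDE subsetIr.
move=> K; rewrite inE => /negP KS KA; apply: KS.
by rewrite -(setID K A) setUC [K :\: A]setDE KA; apply: IS; rewrite subsetIr.
Qed.

(** Fix [x] in [A]. The sizes of [L] (both versions at [x] belong to [S]) and of [R] (forget [x])
    add up to that of [S]. Sets shattered by [L], enlarged by [x], and sets shattered by [R] are
    shattered by [S], with and without [x]. Pajor's inequality for [L] and [R] then forces equality
    throughout: [L] is extremal again and shatters [A] without [x], so induction yields a cube in
    [L], which doubles to one in [S]. *)
Lemma extremal_strongly_shatters S A :
  #|S| = #|shattered S| -> A \in shattered S -> strongly_shatters S A.
Proof.
have [n] := ubnP #|A|; elim: n S A => // n IH S A /ltnSE An cS shA.
have [A0|[x xA]] := set_0Vmem A.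
  move: shA; rewrite inE A0 => /shattersP/(_ set0 (sub0set _))[I IS _].
  apply/strongly_shattersP; exists I => B; rewrite subset0 => /eqP->.
  by rewrite setD0 setU0.
pose L := [set I : {set E} | [&& x \notin I, I \in S & x |: I \in S]].
pose R := [set I :\ x | I in S].
have cLR : #|S| = #|L| + #|R|.
  pose S1 := [set K in S | x \in K]; pose S0 := [set K in S | x \notin K].
  have -> : #|S| = #|S1| + #|S0|.
    rewrite -(cardsID [set K : {set E} | x \in K] S).
    by congr (_ + _); apply: eq_card => K; rewrite !inE // andbC.
  pose S1' := [set K :\ x | K in S1].
  have -> : #|S1| = #|S1'|.
    rewrite card_in_imset // => I J; rewrite !inE => /andP[_ xI] /andP[_ xJ] IJ.
    by rewrite -(setD1K xI) -(setD1K xJ) IJ.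
  have -> : L = S1' :&: S0.
    apply/setP => I; rewrite !inE; apply/and3P/andP => [[xI IS xIS]|[]].
      split; last by rewrite IS xI. apply/imsetP.
      by exists (x |: I); rewrite ?inE ?xIS ?eqxx ?setU1K.
    move/imsetP => [K]; rewrite inE => /andP[KS xK ->] /andP[-> ->].
    by rewrite setD1K.
  have -> : R = S1' :|: S0.
    apply/setP => I; apply/imsetP/setUP => [[K KS ->]|[/imsetP[K]|]].
    - have [xK|xK] := boolP (x \in K).
        by left; apply/imsetP; exists K; rewrite ?inE ?KS.
      by right; rewrite (setDidPl _) ?inE ?KS // disjoint_sym disjoints1.
    - by rewrite inE => /andP[KS _ ->]; exists K.
    - rewrite inE => /andP[IS xI]; exists I => //.
      by rewrite (setDidPl _) // disjoint_sym disjoints1.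
  by rewrite cardsU subnKC // (leq_trans (subset_leq_card (subsetIl _ _))) ?leq_addr.
have cA : #|shattered S| = #|[set B in shattered S | x \in B]| + #|[set B in shattered S | x \notin B]|.
  rewrite -(cardsID [set K : {set E} | x \in K]).
  by congr (_ + _); apply: eq_card => K; rewrite !inE // andbC.
have nxL B : B \in shattered L -> x \notin B.
  rewrite inE => /shattersP/(_ B (subxx _))[I]; rewrite inE => /andP[xI _] <-.
  by rewrite inE (negPf xI).
have subL : [set x |: B | B in shattered L] \subset [set B in shattered S | x \in B].
  apply/subsetP => _ /imsetP[B shB ->]; have xB := nxL _ shB.
  move: shB; rewrite !inE eqxx /= andbT => /shattersP shB; apply/shattersP => K KB.
  have KxB : K :\ x \subset B.
    by apply/subsetP => y; rewrite !inE => /andP[yx /(subsetP KB)]; rewrite !inE (negPf yx).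
  have [I] := shB _ KxB; rewrite inE => /and3P[xI IS xIS] IB.
  have [xK|xK] := boolP (x \in K).
    by exists (x |: I) => //; rewrite -setUIr IB setD1K.
  exists I => //; rewrite setIUr IB; apply/setP => y; rewrite !inE.
  by have [->|_] := eqVneq y x; rewrite ?(negPf xI) ?(negPf xK) /= ?andbF.
have subR : shattered R \subset [set B in shattered S | x \notin B].
  apply/subsetP => B; rewrite !inE => /shattersP shB.
  have xB : x \notin B.
    by have [_ /imsetP[I _ ->] <-] := shB _ (subxx _); rewrite !inE eqxx.
  rewrite xB andbT; apply/shattersP => K /shB[_ /imsetP[I IS ->] <-]; exists I => //.
  apply/setP => y; rewrite !inE; have [->|//] := eqVneq y x.
  by rewrite (negPf xB) !andbF.
have cL : #|[set x |: B | B in shattered L]| = #|shattered L|.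
  rewrite card_in_imset // => B K /nxL xB /nxL xK /setP BK; apply/setP => y.
  by have := BK y; rewrite !inE; have [->|] := eqVneq y x; rewrite ?(negPf xB) ?(negPf xK).
have lL := card_le_shattered L; have lR := card_le_shattered R.
have l1 := subset_leq_card subL; have l2 := subset_leq_card subR.
rewrite cL in l1; move: cS; rewrite cLR cA => cS.
have key a b c d e f : a + b = c + d -> a <= e -> b <= f -> e <= c -> f <= d -> a = e by lia.
have eL : #|L| = #|shattered L| by exact: key cS lL lR l1 l2.
have eL2 : [set x |: B | B in shattered L] = [set B in shattered S | x \in B].
  have key2 a' b c d e f : a' + b = c + d -> a' = e -> b <= f -> f <= d -> c <= e by lia.
  by apply/eqP; rewrite eqEcard subL cL; exact: key2 cS eL lR l2.
have /imsetP[B shB AB] : A \in [set x |: B | B in shattered L] by rewrite eL2 inE shA.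
have BA : B = A :\ x by rewrite AB setU1K ?nxL.
have /strongly_shattersP[I IL] : strongly_shatters L B.
  by apply: IH => //; rewrite BA; have := cardsD1 x A; rewrite xA; lia.
apply/strongly_shattersP; exists (I :\ x) => K KA.
have KxB : K :\ x \subset B by rewrite BA setSD.
have ID : I :\ x :\: A = (I :\: B) :\ x.
  by rewrite BA; apply/setP => y; rewrite !inE; case: (y == x) => //=; rewrite ?andbF.
have := IL _ KxB; rewrite inE => /and3P[xI IS xIS].
have xIB : x \notin I :\: B by apply: contra xI => xI; rewrite inE xI.
have D1 (J : {set E}) : x \notin J -> J :\ x = J.
  by move=> xJ; apply/setDidPl; rewrite disjoint_sym disjoints1.
rewrite ID D1 //; have [xK|xK] := boolP (x \in K).
  by move: xIS; rewrite setUCA setD1K.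
by move: IS; rewrite D1.
Qed.
End Shattering.

(** * Conflict digraphs and orientations *)

Section Digraphs.
Variable T : finType.
Implicit Types (r : rel T) (O A D : {set T * T}) (S : {set {set T * T}}).

Definition conflict O1 O2 : rel T := fun x y => ((x, y) \in O1) && ((y, x) \in O2).
Definition acyclic r := [forall x, forall y, r x y ==> ~~ connect r y x].
Definition sep : rel {set T * T} := fun O1 O2 => acyclic (conflict O1 O2).
Definition add_arc r p q : rel T := fun x y => r x y || (x == p) && (y == q).

Lemma acyclicP r : reflect (forall x y, r x y -> ~~ connect r y x) (acyclic r).
Proof. 
apply: (iffP forallP) => [ac x y|ac x]; first by have /forallP/(_ y)/implyP := ac x.
by apply/forallP => y; apply/implyP/ac.
Qed.

Lemma sub_acyclic r r' : subrel r r' -> acyclic r' -> acyclic r.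
Proof.
move=> rr' /acyclicP ac; apply/acyclicP => x y /rr'/ac; apply: contra.
by apply: connect_sub => u v /rr'; apply: connect1.
Qed.

Lemma eq_acyclic r r' : r =2 r' -> acyclic r = acyclic r'.
Proof. by move=> rr'; apply/idP/idP; apply: sub_acyclic => u v; rewrite rr'. Qed.

Lemma conflictC O1 O2 x y : conflict O1 O2 x y = conflict O2 O1 y x.
Proof. by rewrite /conflict andbC. Qed.

Lemma connect_conflictC O1 O2 x y : connect (conflict O1 O2) x y = connect (conflict O2 O1) y x.
Proof. by rewrite [LHS]connect_rev /=; apply: eq_connect => u v; rewrite /= conflictC. Qed.

Lemma sepC : symmetric sep.
Proof.
move=> O1 O2; apply/acyclicP/acyclicP => ac x y; rewrite conflictC => /ac;
by rewrite connect_conflictC.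
Qed.

Lemma connect_add_arc r p q x y :
  connect (add_arc r p q) x y = connect r x y || connect r x p && connect r q y.
Proof.
have sub : subrel (connect r) (connect (add_arc r p q)).
  by apply: connect_sub => u v ruv; apply: connect1; rewrite /add_arc ruv.
apply/idP/idP => [/connectP[s]|/orP[/sub//|/andP[/sub xp /sub qy]]]; last first.
  apply: connect_trans xp (connect_trans _ qy).
  by apply: connect1; rewrite /add_arc !eqxx orbT.
elim: s x => [x _ ->|z s IH x /= /andP[xz zs] ys]; first by rewrite connect0.
have {IH} := IH _ zs ys; case/orP: xz => [/connect1 xz|/andP[/eqP-> /eqP->]].
  case/orP => [zy|/andP[zp qy]]; first by rewrite (connect_trans xz zy).
  by rewrite (connect_trans xz zp) qy orbT.
by case/orP => [->|/andP[_ ->]]; rewrite connect0 orbT.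
Qed.

Lemma acyclic_add_arc r p q :
  acyclic (add_arc r p q) = acyclic r && ~~ connect r q p.
Proof.
apply/idP/andP => [ac|[/acyclicP ac qp]].
  split; first by apply: sub_acyclic ac => u v ruv; rewrite /add_arc ruv.
  have /acyclicP/(_ p q) := ac; rewrite /add_arc !eqxx orbT => /(_ isT).
  by rewrite connect_add_arc negb_or => /andP[].
apply/acyclicP => x y /orP[xy|/andP[/eqP-> /eqP->]]; rewrite connect_add_arc negb_or.
  rewrite ac //; apply: contra qp => /andP[yp qx].
  exact: connect_trans (connect_trans qx (connect1 xy)) yp.
by rewrite (negPf qp).
Qed.

Lemma cycle_of_connect r x y : irreflexive r -> (forall u v, r u v -> ~~ r v u) ->
  r x y -> connect r y x -> exists c, [/\ uniq c, 2 < size c & cycle r c].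
Proof.
move=> r_irr r_asym rxy /connectP[p0 yp0 xp0].
case/shortenP: yp0 xp0 => p yp up _ xp; exists (y :: p); split=> //.
  case: p yp up xp => [|z [|w p]] //= => [_ _ xy|]; first by rewrite xy r_irr in rxy.
  by move=> /andP[yz _] _ xz; rewrite xz (negPf (r_asym _ _ yz)) in rxy.
by rewrite /= rcons_path yp -xp.
Qed.

Lemma connect_of_cycle r c : cycle r c -> 0 < size c -> exists x y, r x y /\ connect r y x.
Proof.
case: c => // x [|y p] /=; first by rewrite andbT => rxx _; exists x, x.
rewrite rcons_path => /andP[rxy /andP[yp lx]] _; exists x, y; split=> //.
apply: connect_trans (connect1 lx); apply/connectP; by exists p.
Qed.

(** The label is the position along a simple path. Comparing the labels of its two ends gives an
    edge a direction, so an orientation following the path can be written down without mentioning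
    the path. *)
Lemma increasing_path r y x : connect r y x ->
  exists i : T -> nat, connect (fun u v => r u v && (i u < i v)) y x.
Proof.
case/connectP => p0 yp0 xp0; case/shortenP: yp0 xp0 => p yp up _ ->.
exists (fun u => index u (y :: p)); apply/connectP; exists p => //.
apply/(pathP x) => k kp; apply/andP; split; first exact: (pathP x yp).
cbv beta; rewrite -[X in _ < index X _]/(nth x (y :: p) k.+1).
by rewrite !index_uniq //= ltnW.
Qed.

Section Edges.
Variable e : rel T.
Hypotheses (e_sym : symmetric e) (e_irr : irreflexive e).

Definition orientations : {set {set T * T}} :=
  [set O : {set T * T} | [forall x, forall y, (((x, y) \in O) ==> e x y) &&
                                (e x y ==> (((x, y) \in O) != ((y, x) \in O)))]].

Lemma orientationsP O : reflect (total_orientation e O) (O \in orientations).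
Proof.
rewrite inE; apply: (iffP forallP) => [tO|[t1 t2] x].
  split=> [[x y] xyO|x y exy]; have /forallP/(_ y)/andP[/implyP t1 /implyP t2] := tO x.
    exact: t1.
  exact: t2.
apply/forallP => y; apply/andP; split; apply/implyP; first exact: (t1 (x, y)).
exact: t2.
Qed.

Lemma orientation_edge O x y : O \in orientations -> (x, y) \in O -> e x y.
Proof. by move=> /orientationsP[t1 _]; apply: (t1 (x, y)). Qed.

Lemma orientation_rev O x y : O \in orientations -> e x y -> ((y, x) \in O) = ((x, y) \notin O).
Proof. by move=> /orientationsP[_ t2] /t2; case: (_ \in O) (_ \in O) => [] []. Qed.

Lemma orientation_asym O x y : O \in orientations -> (x, y) \in O -> (y, x) \notin O.
Proof.
by move=> tO xyO; rewrite (orientation_rev tO (orientation_edge tO xyO)) xyO.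
Qed.

Lemma conflict_irr O1 O2 : O1 \in orientations -> irreflexive (conflict O1 O2).
Proof.
move=> t1 x; apply/negP => /andP[/(orientation_edge t1)]; by rewrite e_irr.
Qed.

Lemma conflict_asym O1 O2 : O1 \in orientations ->
  forall u v, conflict O1 O2 u v -> ~~ conflict O1 O2 v u.
Proof. by move=> t1 u v /andP[/(orientation_asym t1)/negPf uv _]; rewrite /conflict uv. Qed.

Lemma sep_refl O : O \in orientations -> sep O O.
Proof.
move=> tO; apply/acyclicP => x y /andP[xy]; by rewrite (negPf (orientation_asym tO xy)).
Qed.

Lemma sepP O1 O2 : O1 \in orientations -> reflect (G_separated e O1 O2) (sep O1 O2).
Proof.
move=> t1; apply: (iffP idP) => [/acyclicP ac [c [/and3P[uc sc _] c1 c2]]|gs].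
  have [||x [y [rxy]]] := @connect_of_cycle (conflict O1 O2) c; last by apply/negP/ac.
    by rewrite /conflict; case: c c1 c2 {uc sc} => //= x p; rewrite path_relI => -> ->.
  by case: (c) sc.
apply/acyclicP => x y rxy; apply/negP => cyx; apply: gs.
have [c [uc sc cc]] := cycle_of_connect (conflict_irr O2 t1) (conflict_asym t1) rxy cyx.
have sub (r' : rel T) : subrel (conflict O1 O2) r' -> cycle r' c.
  by move=> rr'; case: c cc {uc sc} => //= u p; apply: sub_path.
exists c; split; last 2 first.
- by apply: sub => u v /andP[].
- by apply: sub => u v /andP[].
by rewrite /graph_cycle uc sc sub // => u v /andP[/(orientation_edge t1)].
Qed.

Lemma orientation_inj (D : {set T * T}) : D \in orientations ->
  {in orientations &, injective (fun O : {set T * T} => O :&: D)}.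
Proof.
move=> tD O1 O2 t1 t2 /setP eq12; apply/setP => -[x y].
have [exy|nexy] := boolP (e x y); last first.
  by apply/idP/idP => [/(orientation_edge t1)|/(orientation_edge t2)] exy; rewrite exy in nexy.
have [xyD|xyD] := boolP ((x, y) \in D).
  by have := eq12 (x, y); rewrite !inE xyD !andbT.
have := eq12 (y, x); rewrite !inE (orientation_rev tD) // xyD !andbT.
by rewrite !(orientation_rev _ exy) // => /(congr1 negb); rewrite !negbK.
Qed.

Lemma card_traces (D : {set T * T}) (S : {set {set T * T}}) :
  D \in orientations -> S \subset orientations -> #|[set O :&: D | O in S]| = #|S|.
Proof.
move=> tD St; rewrite card_in_imset // => O1 O2 /(subsetP St) t1 /(subsetP St) t2.
exact: orientation_inj.
Qed.

End Edges.

Definition undirected (A : {set T * T}) : rel T := fun x y => ((x, y) \in A) || ((y, x) \in A).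
(** Every arc is a bridge, a form suited to adding arcs one by one. It is meant for subsets of an
    orientation, where each edge has one representative. *)
Definition is_forest (A : {set T * T}) :=
  [forall p in A, ~~ connect (undirected (A :\ p)) p.1 p.2].

Lemma undirected_sym A : symmetric (undirected A).
Proof. by move=> x y; rewrite /undirected orbC. Qed.

Lemma is_forestP A :
  reflect (forall p, p \in A -> ~~ connect (undirected (A :\ p)) p.1 p.2) (is_forest A).
Proof. exact: (iffP forall_inP). Qed.

Lemma connect_undirected_sym A x y : connect (undirected A) x y = connect (undirected A) y x.
Proof. by rewrite (sym_connect_sym (@undirected_sym A)). Qed.

(** If the arc [(x, y)] of [A] were no bridge, shattering would provide one member following a cycle
    through it and another member reversing every edge of that cycle, hence a directed cycle in
    their conflict. *)
Lemma shattered_is_forest (e : rel T) (D : {set T * T}) (S : {set {set T * T}}) A :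
  symmetric e -> D \in orientations e -> S \subset orientations e ->
  {in S &, forall O O', sep O O'} -> A \in shattered [set O :&: D | O in S] ->
  (A \subset D) && is_forest A.
Proof.
move=> e_sym tD St Ss; rewrite inE => /shattersP shA.
have AD : A \subset D.
  have [_ /imsetP[O _ ->]] := shA _ (subxx _); rewrite -setIA => <-.
  by rewrite (subset_trans (subsetIr _ _)) // subsetIl.
rewrite AD; apply/is_forestP => -[x y] /= xyA; rewrite connect_undirected_sym; apply/negP.
case/increasing_path => i; set r := (fun u v => _) => yx.
(* [B1] prescribes [(x, y)] and rising labels on the other arcs, [B2] prescribes the reverse of
   [(x, y)] and falling labels. *)
pose B1 := (x, y) |: [set q in A :\ (x, y) | i q.1 < i q.2].
pose B2 := [set q in A :\ (x, y) | i q.2 < i q.1].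
have [_ /imsetP[O1 O1S ->] O1B] : exists2 I, I \in [set O :&: D | O in S] & I :&: A = B1.
  apply: shA; apply/subsetP => q; rewrite 2!inE => /orP[/eqP->//|].
  by rewrite !inE => /andP[/andP[]].
have [_ /imsetP[O2 O2S ->] O2B] : exists2 I, I \in [set O :&: D | O in S] & I :&: A = B2.
  by apply: shA; apply/subsetP => q; rewrite !inE => /andP[/andP[]].
have {O1B} O1B q : q \in A -> (q \in O1) = (q \in B1).
  by move=> qA; rewrite -O1B !inE qA (subsetP AD) ?andbT.
have {O2B} O2B q : q \in A -> (q \in O2) = (q \in B2).
  by move=> qA; rewrite -O2B !inE qA (subsetP AD) ?andbT.
have t1 := subsetP St _ O1S; have t2 := subsetP St _ O2S.
have eA u v : (u, v) \in A -> e u v by move=> /(subsetP AD); exact: orientation_edge.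
have xyc : conflict O1 O2 x y.
  rewrite /conflict O1B ?setU11 //= (orientation_rev t2 (eA _ _ xyA)) O2B //.
  by rewrite !inE eqxx.
have /acyclicP/(_ x y xyc)/negP[] := Ss _ _ O1S O2S.
apply: connect_sub yx => u v /andP[uv iuv]; apply: connect1; rewrite /conflict.
case/orP: uv; rewrite in_setD1 => /andP[uvn uvA].
  rewrite O1B // (orientation_rev t2 (eA _ _ uvA)) O2B // !inE uvn uvA /= iuv.
  by rewrite orbT -leqNgt ltnW.
rewrite (orientation_rev t1 (eA _ _ uvA)) O1B // O2B // !inE uvn uvA /= iuv (negPf uvn).
by rewrite -leqNgt ltnW.
Qed.

Definition forests (D : {set T * T}) := [set A in powerset D | is_forest A].

Lemma card_separated_le (e : rel T) (D : {set T * T}) (S : {set {set T * T}}) :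
  symmetric e -> D \in orientations e -> S \subset orientations e ->
  {in S &, forall O O', sep O O'} -> #|S| <= #|forests D|.
Proof.
move=> e_sym tD St Ss; rewrite -(card_traces tD St).
apply: leq_trans (card_le_shattered _) (subset_leq_card _).
by apply/subsetP => A /(shattered_is_forest e_sym tD St Ss); rewrite !inE.
Qed.

(** Equality makes the traces an extremal family whose shattered sets are exactly the forests, so
    each forest is strongly shattered. *)
Lemma extremal_reorientations (e : rel T) (D : {set T * T}) (S : {set {set T * T}}) A :
  symmetric e -> D \in orientations e -> S \subset orientations e ->
  {in S &, forall O O', sep O O'} -> #|S| = #|forests D| -> A \in forests D ->
  exists O, O \in orientations e /\
    forall O', O' \in orientations e ->
      (forall p, p \in D :\: A -> (p \in O') = (p \in O)) -> O' \in S.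
Proof.
move=> e_sym tD St Ss cS fA; set SD := [set O :&: D | O in S].
have sub : shattered SD \subset forests D.
  by apply/subsetP => B /(shattered_is_forest e_sym tD St Ss); rewrite !inE.
have eqsh : shattered SD = forests D.
  apply/eqP; rewrite eqEcard sub -cS -(card_traces tD St).
  exact: card_le_shattered.
have /strongly_shattersP[I IS] : strongly_shatters SD A.
  by apply: extremal_strongly_shatters; rewrite eqsh // (card_traces tD St).
have /imsetP[O OS OI] := IS _ (subxx A); exists O.
split=> [|O' tO' O'O]; first exact: subsetP St _ OS.
have AD : A \subset D by move: fA; rewrite !inE => /andP[].
have /imsetP[O2 O2S O2I] := IS _ (subsetIr O' A).
have -> // : O' = O2; apply: (orientation_inj tD) => //; first exact: subsetP St _ O2S.
rewrite -O2I; apply/setP => p; rewrite !inE.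
have [pA|pA] := boolP (p \in A); first by rewrite (subsetP AD) //= orbF.
have /setP/(_ p) := OI; rewrite !inE (negPf pA) /= orbF => ->.
have [pD|] := boolP (p \in D); last by rewrite !andbF.
by rewrite O'O ?inE ?pA // andbF orbF.
Qed.
End Digraphs.

(** * Forests and a family of maximum size *)

Section Forests.
Import Order.TTheory GRing.Theory Num.Theory.
Variable T : finType.
Implicit Types (A B D : {set T * T}) (x y u v : T).

Lemma connect_undirectedU1 A x y u v :
  connect (undirected ((x, y) |: A)) u v =
  [|| connect (undirected A) u v, connect (undirected A) u x && connect (undirected A) y v |
      connect (undirected A) u y && connect (undirected A) x v].
Proof.
have E : undirected ((x, y) |: A) =2 add_arc (add_arc (undirected A) x y) y x.
  move=> a b; rewrite /undirected /add_arc !inE !xpair_eqE.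
  by case: (_ \in A) (_ \in A) (a == x) (a == y) (b == x) (b == y) => [] [] [] [] [] [].
have tr z : connect (undirected A) u z -> connect (undirected A) z v -> connect (undirected A) u v.
  exact: connect_trans.
rewrite (eq_connect E) !connect_add_arc !connect0 ?andbT /=; move: (tr x) (tr y).
case: (connect _ u v) => //; case: (connect _ u x) => //; case: (connect _ u y) => //;
  case: (connect _ x v) => //; case: (connect _ y v) => // a b;
  by [have := a isT isT | have := b isT isT].
Qed.

Lemma is_forestU1 A x y : is_forest A -> ~~ connect (undirected A) x y -> is_forest ((x, y) |: A).
Proof.
move=> /is_forestP fA nxy.
have xyA : (x, y) \notin A.
  by apply: contra nxy => xyA; apply: connect1; rewrite /undirected xyA.
apply/is_forestP => p /setU1P[->|pA]; first by rewrite setU1K.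
have pxy : p != (x, y) by apply: contraNneq xyA => <-.
have -> : ((x, y) |: A) :\ p = (x, y) |: (A :\ p).
  by apply/setP => q; rewrite !inE; have [->|] //= := eqVneq q (x, y); rewrite eq_sym pxy.
have sub : subrel (connect (undirected (A :\ p))) (connect (undirected A)).
  apply: connect_sub => u v; rewrite /undirected !inE => uv; apply: connect1.
  by case/orP: uv => /andP[_ ->]; rewrite ?orbT.
have pp : connect (undirected A) p.1 p.2.
  by apply: connect1; rewrite /undirected -surjective_pairing pA.
rewrite connect_undirectedU1 (negPf (fA _ pA)) /=; apply: contra nxy.
case/orP => /andP[/sub a /sub b].
  rewrite connect_undirected_sym; apply: connect_trans b _.
  by rewrite connect_undirected_sym; apply: connect_trans pp; rewrite connect_undirected_sym.
apply: connect_trans b _; rewrite connect_undirected_sym.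
by apply: connect_trans pp; rewrite connect_undirected_sym.
Qed.

Lemma is_forest_subset A B : B \subset A -> is_forest A -> is_forest B.
Proof.
move=> BA /is_forestP fA; apply/is_forestP => p pB; apply: contra (fA _ (subsetP BA _ pB)).
apply: connect_sub => u v uv; apply: connect1; move: uv; rewrite /undirected !inE.
by case/orP => /andP[-> /(subsetP BA)->]; rewrite ?orbT.
Qed.

(** Remove an arc, solve for the rest by induction, and shift the potential on the component of the
    head: the other arcs do not notice the shift, and its amount is free. *)
Lemma forest_potential A (w : T * T -> int) : is_forest A ->
  exists pot : T -> int, forall x y, (x, y) \in A -> (pot y - pot x = w (x, y))%R.
Proof.
have [n] := ubnP #|A|; elim: n A => // n IH A /ltnSE An fA.
have [->|[[x y] xyA]] := set_0Vmem A; first by exists (fun=> 0%R) => x y; rewrite inE.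
have [||pot potE] := IH (A :\ (x, y)); last 1 first.
- pose c := (w (x, y) - (pot y - pot x))%R; set B := A :\ (x, y).
  exists (fun z => if connect (undirected B) y z then pot z + c else pot z)%R => u v uvA.
  have [[-> ->]|uvn] := eqVneq (u, v) (x, y).
    have /is_forestP/(_ _ xyA) /= := fA; rewrite connect_undirected_sym => /negPf ->.
    by rewrite connect0 /c; lia.
  have uvB : (u, v) \in B by rewrite !inE uvn.
  have -> : connect (undirected B) y u = connect (undirected B) y v.
    apply: same_connect_r; first exact: sym_connect_sym (@undirected_sym _ _).
    by apply: connect1; rewrite /undirected uvB.
  by have := potE _ _ uvB; clearbody c; case: ifP => _ <-; lia.
- by apply: leq_trans An; rewrite [X in _ <= X](cardsD1 (x, y)) xyA.
- by apply: is_forest_subset fA; rewrite subD1set.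
Qed.
End Forests.

Section Reorientation.
Import Order.TTheory GRing.Theory Num.Theory.
Variables (T : finType) (e : rel T) (D : {set T * T}).
Hypotheses (e_sym : symmetric e) (e_irr : irreflexive e) (tD : D \in orientations e).
Implicit Types (I J O : {set T * T}).

Definition reorient I : {set T * T} := I :|: [set p in [set (q.2, q.1) | q in D :\: I]].

Lemma mem_reorient I x y : ((x, y) \in reorient I) = ((x, y) \in I) || ((y, x) \in D :\: I).
Proof.
rewrite in_setU [in X in _ || X]inE; congr (_ || _).
apply/imsetP/idP => [[[a b] abD [-> ->]] //|yxD]; by exists (y, x).
Qed.

Lemma reorient_trace I : I \subset D -> reorient I :&: D = I.
Proof.
move=> ID; apply/setP => -[x y]; rewrite in_setI mem_reorient.
have [xyI|xyI] /= := boolP ((x, y) \in I); first by rewrite (subsetP ID).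
rewrite in_setD; apply/negP => /andP[/andP[_ yxD]].
by rewrite (negPf (orientation_asym tD yxD)).
Qed.

Lemma reorient_orientation I : I \subset D -> reorient I \in orientations e.
Proof.
move=> ID; apply/orientationsP; split=> [[x y]|x y exy].
  rewrite mem_reorient => /orP[/(subsetP ID)/(orientation_edge tD)//|].
  by rewrite in_setD => /andP[_ /(orientation_edge tD)]; rewrite e_sym.
rewrite !mem_reorient !in_setD; have := orientation_rev tD exy.
have := subsetP ID (x, y); have := subsetP ID (y, x).
by case: (_ \in I) (_ \in I) (_ \in D) (_ \in D) => [] [] [] [] // a b c;
  by [have := a isT | have := b isT].
Qed.

Lemma trace_reorient O : O \in orientations e -> reorient (O :&: D) = O.
Proof.
move=> tO; apply: (orientation_inj tD) => //; last by rewrite reorient_trace ?subsetIr.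
by rewrite reorient_orientation ?subsetIr.
Qed.

(** An arbitrary linear order on the edges; both directions of an edge share the position of its arc
    in [D]. *)
Let rk (p : T * T) := if p \in D then index p (enum D) else index (p.2, p.1) (enum D).

Let rk_inj u v x y : e u v -> e x y -> rk (u, v) = rk (x, y) ->
  (u, v) = (x, y) \/ (v, u) = (x, y).
Proof.
move=> euv exy; rewrite /rk /=.
have ind p q : p \in D -> q \in D -> index p (enum D) = index q (enum D) -> p = q.
  by move=> pD qD E; rewrite -(nth_index q (_ : p \in enum D)) ?mem_enum // E nth_index ?mem_enum.
have := orientation_rev tD euv; have := orientation_rev tD exy.
case: ifP => uvD; case: ifP => xyD /= yxD vuD E.
- by left; apply: ind.
- by right; have [-> ->] := ind _ _ uvD yxD E.
- by right; apply: ind.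
- by left; have [-> ->] := ind _ _ vuD yxD E.
Qed.

Let rk_sym u v : e u v -> rk (v, u) = rk (u, v).
Proof. by move=> euv; rewrite /rk /= (orientation_rev tD euv); case: (_ \in D). Qed.

(* Every directed cycle agrees with [D] on its edge of largest rank. *)
Definition lex_family := [set O in orientations e |
  [forall p in O, (p \notin D) ==>
     ~~ connect (fun u v => ((u, v) \in O) && (rk (u, v) < rk p)) p.2 p.1]].

(** A directed cycle of the conflict is followed by [O1] and reversed by [O2], yet only one of them
    can agree with [D] on its edge of largest rank. Adding the edges by increasing rank leaves a
    single edge to examine at each stage. *)
Lemma lex_family_sep : {in lex_family &, forall O O', sep O O'}.
Proof.
move=> O1 O2; rewrite !inE => /andP[t1 /forall_inP l1] /andP[t2 /forall_inP l2].
have {}t1 : O1 \in orientations e by rewrite inE.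
have {}t2 : O2 \in orientations e by rewrite inE.
pose r k := [rel u v | conflict O1 O2 u v && (rk (u, v) < k)].
have re u v : conflict O1 O2 u v -> e u v by case/andP => /(orientation_edge t1).
suff ac k : acyclic (r k).
  apply: sub_acyclic (ac (#|D|.+1)) => u v uv /=; rewrite uv /= ltnS cardE /rk.
  by case: ifP => _; exact: index_size.
elim: k => [|k ac]; first by apply/acyclicP => x y; rewrite /r /= ltn0 andbF.
have [/existsP[[a b] /= /andP[rab /eqP kab]]|nk] :=
    boolP [exists p : T * T, conflict O1 O2 p.1 p.2 && (rk p == k)]; last first.
  apply: sub_acyclic ac => u v /=; rewrite ltnS leq_eqVlt => /andP[ruv /orP[/eqP kuv|->]].
    by case/existsP: nk; exists (u, v); rewrite /= ruv kuv eqxx.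
  by rewrite ruv.
have rE : subrel (r k.+1) (add_arc (r k) a b).
  move=> u v /= /andP[ruv]; rewrite /add_arc ltnS leq_eqVlt /= ruv => /orP[/eqP kuv|->//].
  have [[-> ->]|[vb ua]] := rk_inj (re _ _ ruv) (re _ _ rab) (etrans kuv (esym kab)).
    by rewrite !eqxx orbT.
  by have /negP[] := conflict_asym t1 rab; rewrite -ua -vb.
apply: sub_acyclic rE _; rewrite acyclic_add_arc ac /=.
have /andP[abO1 baO2] := rab.
have [abD|abD] := boolP ((a, b) \in D); last first.
  have /implyP/(_ abD) := l1 _ abO1; apply: contra; apply: connect_sub => u v.
  by case/andP => /andP[uvO _] luv; apply: connect1; rewrite uvO kab.
have /implyP/(_ (orientation_asym tD abD)) := l2 _ baO2; apply: contra => /= ba.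
rewrite (connect_rev _ b a) /= in ba; apply: connect_sub ba => u v /= /andP[/andP[_ vuO] luv].
apply: connect1; rewrite vuO /=.
by rewrite (rk_sym (re _ _ rab)) kab -(rk_sym (orientation_edge t2 vuO)).
Qed.

(** Every forest [A] is strongly shattered by the traces. Take a potential whose differences equal
    the weights [w] on [A], and direct the other edges so that the difference is at most [w].
    Whatever the directions on [A], the weights along a directed cycle have non-negative sum, so its
    arc of largest rank has positive weight and thus lies in [D]. *)
Lemma card_lex_family : #|lex_family| = #|forests D|.
Proof.
have Lt : lex_family \subset orientations e by apply/subsetP => O; rewrite !inE => /andP[].
apply/eqP; rewrite eqn_leq (card_separated_le e_sym tD) //; last exact: lex_family_sep.
rewrite -(card_traces tD Lt); apply: leq_trans (card_strongly_shattered_le _).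
apply: subset_leq_card; apply/subsetP => A; rewrite !inE => /andP[AD fA].
(* A simple path has fewer than [N] arcs, so one power of [N] outweighs all the lower powers met
   along it. *)
pose N := #|T|.+1; pose w p : int := if p \in D then Posz (N ^ rk p) else (- Posz (N ^ rk p))%R.
have [pot potE] := forest_potential w fA.
pose I := [set p in D :\: A | (pot p.2 - pot p.1 <= w p)%R].
apply/strongly_shattersP; exists I => B BA.
have JD : (I :\: A) :|: B \subset D.
  rewrite subUset (subset_trans BA AD) andbT; apply/subsetP => p.
  by rewrite !inE => /andP[_ /andP[/andP[_ ->]]].
apply/imsetP; exists (reorient ((I :\: A) :|: B)); last by rewrite reorient_trace.
set O := reorient _; have tO : O \in orientations e by exact: reorient_orientation.
have wN x y : e x y -> w (y, x) = (- w (x, y))%R.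
  move=> exy; rewrite /w (orientation_rev tD exy) (rk_sym exy).
  by case: (_ \in D); rewrite /= ?opprK.
have potO x y : (x, y) \in O -> (pot y - pot x <= w (x, y))%R.
  rewrite /O mem_reorient !inE => /orP[/orP[/andP[_ /andP[_ //]]|/(subsetP BA)/potE ->]|].
    by [].
  rewrite negb_or !negb_and !negbK => /andP[nI yxD].
  have eyx := orientation_edge tD yxD; rewrite (wN _ _ eyx).
  move: nI; rewrite yxD /= orbF; have [yxA _|yxA /=] := boolP ((y, x) \in A).
    by rewrite -(potE _ _ yxA) opprB.
  by case/andP => + _; rewrite -ltNge -[(pot y - pot x)%R]opprB lerN2 => /ltW.
rewrite inE tO; apply/forall_inP => -[x y] xyO; apply/implyP => xyD /=; apply/negP.
case/connectP => p0 yp0 xp0; case/shortenP: yp0 xp0 => p yp up _ xp.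
have exy := orientation_edge tO xyO.
set k := rk (x, y) in yp.
have k0 : 0 < k.
  case: p yp up xp => [|z p] /=; first by move=> _ _ xy; rewrite xy e_irr in exy.
  by case/andP=> /andP[_ kz]; case: (k) kz.
have sz : size p <= #|T| by have := max_card (mem (y :: p)); rewrite (card_uniqP up) => /ltnW.
have bound : (pot x - pot y <= Posz (size p * N ^ k.-1))%R.
  rewrite xp; elim: (p) (y) yp => [|z q IH] u /=; first by rewrite subrr.
  case/andP=> /andP[/potO uz kz] /IH{}IH.
  have : (w (u, z) <= Posz (N ^ k.-1))%R.
    have : N ^ rk (u, z) <= N ^ k.-1 by rewrite leq_pexp2l // -ltnS prednK.
    rewrite /w; case: ifP => _ le; first by rewrite lez_nat.
    by rewrite (@le_trans _ _ 0%R) ?oppr_le0.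
  move=> wz; rewrite mulSn addnC PoszD -(subrKA (pot z)) lerD //; exact: le_trans uz wz.
have lt : size p * N ^ k.-1 < N ^ k by rewrite -[in ltnRHS](prednK k0) expnS ltn_pmul2r ?expn_gt0.
have := potO _ _ xyO; rewrite /w (negPf xyD) -/k -opprB lerN2 => le; have := le_trans le bound.
by rewrite lez_nat leqNgt lt.
Qed.
End Reorientation.

(** * Minors and transitivity of conflicts *)

Section Minors.
Variables (T : finType) (g : rel T).
Hypothesis g_sym : symmetric g.
Implicit Types (B C : {set T}) (x y z : T).

Definition connected_set B := forall x y, x \in B -> y \in B -> connect (induced g B) x y.

Lemma connected_set1 x : connected_set [set x].
Proof. by move=> y z /set1P-> /set1P->. Qed.

Lemma induced_sym B : symmetric (induced g B).
Proof. by move=> x y; rewrite /induced g_sym [(x \in B) && _]andbC. Qed.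

Lemma connect_induced_subset B C x y : B \subset C ->
  connect (induced g B) x y -> connect (induced g C) x y.
Proof.
move=> BC; apply: connect_sub => u v /and3P[guv uB vB]; apply: connect1.
by rewrite /induced guv !(subsetP BC).
Qed.

Lemma connected_setU B C x y : connected_set B -> connected_set C ->
  x \in B -> y \in C -> g x y -> connected_set (B :|: C).
Proof.
move=> cB cC xB yC gxy.
have cx z : z \in B :|: C -> connect (induced g (B :|: C)) x z.
  case/setUP => zz; first by apply: connect_induced_subset (cB _ _ xB zz); apply: subsetUl.
  apply: (@connect_trans _ _ y); last first.
    by apply: connect_induced_subset (cC _ _ yC zz); apply: subsetUr.
  by apply: connect1; rewrite /induced gxy !inE xB yC orbT.
move=> u v /cx xu /cx; apply: connect_trans.
by rewrite (sym_connect_sym (@induced_sym _)).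
Qed.

Lemma connected_set_path x p : path g x p -> connected_set [set z in x :: p].
Proof.
elim: p x => [x _|y p IH x /= /andP[gxy yp]].
  have -> : [set z in [:: x]] = [set x] by apply/setP => z; rewrite !inE.
  exact: connected_set1.
have -> : [set z in [:: x, y & p]] = [set x] :|: [set z in y :: p].
  by apply/setP => z; rewrite !inE.
apply: (connected_setU (@connected_set1 x) (IH _ yp) _ _ gxy); by rewrite !inE eqxx.
Qed.

Definition adjacent B C := [exists x in B, exists y in C, g x y].

Lemma adjacentP B C : reflect (exists x y, [/\ x \in B, y \in C & g x y]) (adjacent B C).
Proof.
apply: (iffP exists_inP) => [[x xB /exists_inP[y yC gxy]]|[x [y [xB yC gxy]]]].
  by exists x, y.
by exists x => //; apply/exists_inP; exists y.
Qed.

Lemma adjacentC B C : adjacent B C = adjacent C B.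
Proof. by apply/adjacentP/adjacentP => -[x [y [? ? ?]]]; exists y, x; rewrite g_sym. Qed.

Lemma adjacentI x y B C : g x y -> x \in B -> y \in C -> adjacent B C.
Proof. by move=> gxy xB yC; apply/adjacentP; exists x, y. Qed.

Lemma K4_minor B0 B1 B2 B3 :
  connected_set B0 -> connected_set B1 -> connected_set B2 -> connected_set B3 ->
  [disjoint B0 & B1] -> [disjoint B0 & B2] -> [disjoint B0 & B3] ->
  [disjoint B1 & B2] -> [disjoint B1 & B3] -> [disjoint B2 & B3] ->
  adjacent B0 B1 -> adjacent B0 B2 -> adjacent B0 B3 ->
  adjacent B1 B2 -> adjacent B1 B3 -> adjacent B2 B3 -> has_minor g K4_rel.
Proof.
move=> c0 c1 c2 c3 d01 d02 d03 d12 d13 d23 a01 a02 a03 a12 a13 a23.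
have ne B C : adjacent B C -> (B != set0) && (C != set0).
  by case/adjacentP => x [y [xB yC _]]; apply/andP; split; apply/set0Pn; [exists x|exists y].
have [/andP[n0 n1] /andP[n2 n3]] := (ne _ _ a01, ne _ _ a23).
exists (fun i : 'I_4 => nth set0 [:: B0; B1; B2; B3] i); split.
- by case=> [[|[|[|[|]]]]].
- by case=> [[|[|[|[|i]]]] Hi] // [[|[|[|[|j]]]] Hj] //=; rewrite 1?disjoint_sym.
- by case=> [[|[|[|[|]]]]].
case=> [[|[|[|[|i]]]] Hi] // [[|[|[|[|j]]]] Hj] //= _; apply/adjacentP => //;
by rewrite adjacentC.
Qed.

Lemma K23_minor x y B0 B1 B2 : x != y ->
  connected_set B0 -> connected_set B1 -> connected_set B2 ->
  [disjoint B0 & B1] -> [disjoint B0 & B2] -> [disjoint B1 & B2] ->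
  x \notin B0 :|: B1 :|: B2 -> y \notin B0 :|: B1 :|: B2 ->
  adjacent [set x] B0 -> adjacent [set x] B1 -> adjacent [set x] B2 ->
  adjacent [set y] B0 -> adjacent [set y] B1 -> adjacent [set y] B2 ->
  has_minor g K23_rel.
Proof.
move=> xy c0 c1 c2 d01 d02 d12.
rewrite !inE !negb_or => /andP[/andP[x0 x1] x2] /andP[/andP[y0 y1] y2] ax0 ax1 ax2 ay0 ay1 ay2.
have ne z B : adjacent [set z] B -> B != set0.
  by case/adjacentP => ? [u [_ uB _]]; apply/set0Pn; exists u.
exists (fun u : 'I_2 + 'I_3 => match u with
  | inl i => nth set0 [:: [set x]; [set y]] i | inr i => nth set0 [:: B0; B1; B2] i end); split.
- case=> [[[|[|]]]|[[|[|[|]]]]] //= _; try by [exact: ne ax0|exact: ne ax1|exact: ne ax2].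
    by apply/set0Pn; exists x; rewrite inE.
  by apply/set0Pn; exists y; rewrite inE.
- have d1 z B : z \notin B -> [disjoint [set z] & B] by rewrite disjoints1.
  by case=> [[[|[|i]] Hi]|[[|[|[|i]]] Hi]] // [[[|[|j]] Hj]|[[|[|[|j]]] Hj]] //= _;
    do ?[exact: d1 | (rewrite disjoint_sym; exact: d1)|by []|by rewrite disjoint_sym
     |by rewrite d1 // inE|by rewrite d1 // inE eq_sym].
- by case=> [[[|[|i]] Hi]|[[|[|[|i]]] Hi]] //=; apply: connected_set1.
case=> [[[|[|i]] Hi]|[[|[|[|i]]] Hi]] // [[[|[|j]] Hj]|[[|[|[|j]]] Hj]] //= _;
  by apply/adjacentP; rewrite // adjacentC.
Qed.

Lemma split_first (a : pred T) (p : seq T) : has a p ->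
  exists m u r, [/\ p = m ++ u :: r, a u & {in m, forall z, ~~ a z}].
Proof.
elim: p => //= x p IH; have [ax _|nax /IH[m [u [r [-> au am]]]]] := boolP (a x).
  by exists [::], x, p.
by exists (x :: m), u, r; split=> // z; rewrite inE => /predU1P[->|/am].
Qed.

(* The set [B] is a connected set off both paths attached to their two ends, so together with
   two internally disjoint stretches of the paths with common ends it would give a [K_{2,3}]
   minor unless one of the stretches is an edge. *)
Lemma conflict_reroute (e : rel T) O O1 O2 B t q1 q2 :
  symmetric e -> subrel e g -> ~ has_minor g K23_rel ->
  O \in orientations e -> O1 \in orientations e -> O2 \in orientations e ->
  sep O O1 -> sep O O2 ->
  connected_set B -> adjacent [set t] B -> adjacent [set last t q1] B -> last t q2 = last t q1 ->
  path (conflict O O1) t q1 -> path (conflict O2 O) t q2 ->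
  uniq (t :: q1) -> uniq (t :: q2) ->
  {in t :: q1, forall z, z \notin B} -> {in t :: q2, forall z, z \notin B} ->
  connect (conflict O2 O1) t (last t q1).
Proof.
move=> e_sym eg nK23 tO tO1 tO2 /acyclicP s1 /acyclicP s2.
have [n] := ubnP (size q2); elim: n => // n IH in B t q1 q2 * => /ltnSE qn.
move=> cB tB sB lastq p1 p2 u1 u2 B1 B2.
have [q20|q2n] := eqVneq q2 [::]; first by rewrite -lastq q20.
have hq : has (mem q1) q2.
  apply/hasP; exists (last t q2).
    by case: (q2) q2n => //= z q _; rewrite mem_last.
  have: last t q2 \in t :: q1 by rewrite lastq mem_last.
  rewrite inE => /predU1P[lt|//]; case: (q2) q2n lt u2 => //= z q _ <-.
  by rewrite mem_last.
(* With [u] the first vertex of [q2] on [q1], the stretches [m1] and [m] from [t] to [u] have no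
   inner vertex in common. *)
have [m [u [r [q2E uq1 mq1]]]] := split_first hq.
rewrite /= in uq1 mq1; case/splitPr: {1}q1 / uq1 (erefl q1) => m1 r1 q1E.
have sub O' O'' : O' \in orientations e -> subrel (conflict O' O'') g.
  by move=> tO' x y /andP[/(orientation_edge tO')/eg].
rewrite -q1E in lastq sB p1 u1 B1 mq1 hq *.
move: (p1) (p2); rewrite q2E !cat_path /= => /and3P[pm1 am1 pr1] /and3P[pm am pr].
move: (u1) (u2); rewrite q2E /= !mem_cat !inE !negb_or !cat_uniq /= !negb_or.
move=> /andP[/and3P[tm1 tu tr1] /and3P[um1 /andP[um1' mr1] /andP[ur1 ur1']]].
move=> /andP[/and3P[tm _ tr] /and3P[um /andP[um' mr] /andP[ur ur']]].
have tu' : connect (conflict O2 O1) t u.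
  (* A stretch consisting of one edge: if [O2] directed it from [u] to [t], it would close a cycle
     with the reverse of [m] in the conflict of [O] and [O2]. The case of an empty [m] is the same
     with [O1]. *)
  case m1E: m1 => [|x1 m1'].
    rewrite m1E /= in am1; apply: connect1; have /andP[tuO utO1] := am1.
    rewrite /conflict utO1 andbT; apply/negPn/negP => tuO2.
    have utO2 : (u, t) \in O2 by rewrite (orientation_rev tO2) // (orientation_edge tO tuO).
    have /negP[] : ~~ connect (conflict O O2) u t by apply: s2; rewrite /conflict tuO.
    rewrite connect_conflictC; apply/connectP; exists (rcons m u); last by rewrite last_rcons.
    by rewrite rcons_path pm.
  case mE: m => [|x m'].
    rewrite mE /= in am; apply: connect1; have /andP[tuO2 utO] := am.
    rewrite /conflict tuO2 /=; apply/negPn/negP => utO1.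
    have etu := orientation_edge tO2 tuO2.
    have tuO1 : (t, u) \in O1 by rewrite (orientation_rev tO1) // e_sym.
    have /negP[] : ~~ connect (conflict O O1) t u by apply: s1; rewrite /conflict utO.
    apply/connectP; exists (rcons m1 u); last by rewrite last_rcons.
    by rewrite rcons_path pm1.
  (* Both stretches have inner vertices. The hubs are [t] and [u]; the third branch set is [B]
     together with the rest of [q1], which [B] reaches at its last vertex. *)
  case: nK23.
  pose B3 := B :|: [set z in r1].
  have cp O' O'' z p : O' \in orientations e -> path (conflict O' O'') z p ->
      connected_set [set w in z :: p].
    by move=> tO' zp; apply: connected_set_path; apply: sub_path zp; apply: sub.
  apply: (@K23_minor t u [set z in m1] [set z in m] B3) => //.
  - by rewrite m1E; move: pm1; rewrite m1E /= => /andP[_]; apply: cp.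
  - by rewrite mE; move: pm; rewrite mE /= => /andP[_]; apply: cp.
  - rewrite /B3; case r1E: r1 => [|z1 r1'].
      by rewrite (_ : [set z in [::]] = set0) ?setU0 //; apply/setP => z; rewrite !inE.
    have /adjacentP[x0 [y0 [/set1P-> y0B gxy]]] := sB.
    rewrite setUC; apply: (connected_setU _ cB _ y0B gxy).
      by move: pr1; rewrite r1E /= => /andP[_]; apply: cp.
    by rewrite last_cat r1E /= inE mem_last.
  - rewrite disjoint_sym; apply/pred0P => z; rewrite /= !inE; apply/negP => /andP[zm zm1].
    by have := mq1 _ zm; rewrite mem_cat zm1.
  - apply/pred0P => z; rewrite /= !inE; apply/negP => /andP[zm1 /orP[zB|zr1]].
      by have := B1 z; rewrite zB inE mem_cat zm1 orbT => /(_ isT).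
    by move/hasPn: mr1 => /(_ _ zr1); rewrite /= zm1.
  - apply/pred0P => z; rewrite /= !inE; apply/negP => /andP[zm /orP[zB|zr1]].
      by have := B2 z; rewrite zB q2E inE mem_cat zm orbT => /(_ isT).
    by have := mq1 _ zm; rewrite mem_cat inE zr1 !orbT.
  - by rewrite !inE !negb_or tm1 tm tr1 B1 // inE eqxx.
  - by rewrite !inE !negb_or um1' um' ur1 B1 // inE mem_cat inE eqxx !orbT.
  - move: pm1; rewrite m1E /= => /andP[tx _].
    by apply: (adjacentI (sub _ _ tO _ _ tx)); rewrite !inE eqxx.
  - move: pm; rewrite mE /= => /andP[tx _].
    by apply: (adjacentI (sub _ _ tO2 _ _ tx)); rewrite !inE eqxx.
  - have /adjacentP[x0 [y0 [/set1P-> y0B gxy]]] := tB.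
    by apply: (adjacentI gxy); rewrite !inE ?eqxx ?y0B.
  - rewrite adjacentC; apply: (adjacentI (sub _ _ tO _ _ am1)); rewrite !inE ?eqxx //.
    by rewrite m1E /= mem_last.
  - rewrite adjacentC; apply: (adjacentI (sub _ _ tO2 _ _ am)); rewrite !inE ?eqxx //.
    by rewrite mE /= mem_last.
  - move: pr1 sB; rewrite last_cat /B3; case r1E: r1 => [|z1 r1'] /=.
      move=> _ /adjacentP[x0 [y0 [/set1P-> y0B gxy]]].
      by apply: (adjacentI gxy); rewrite !inE ?eqxx ?y0B.
    case/andP=> uz _ _; apply: (adjacentI (sub _ _ tO _ _ uz)); by rewrite !inE eqxx ?orbT.
apply: connect_trans tu' _; rewrite last_cat /=.
have lastr : last u r = last u r1 by move: lastq; rewrite q2E !last_cat.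
have /adjacentP[xt [yt [/set1P xtE yB gty]]] := tB; rewrite {xt}xtE in gty.
(* Continue from [u], absorbing [t] and [m] into the connected set so that it touches the new
   starting point. *)
apply: (IH (B :|: [set z in t :: m]) u r1 r) => //.
- by move: qn; rewrite q2E size_cat /= addnS; apply: leq_trans; rewrite ltnS leq_addl.
- rewrite setUC; apply: (connected_setU _ cB _ yB gty); last by rewrite !inE eqxx.
  by apply: connected_set_path; apply: sub_path pm; apply: sub.
- rewrite adjacentC; apply: (adjacentI (sub _ _ tO2 _ _ am)); rewrite !inE ?eqxx //.
  by rewrite -in_cons mem_last orbT.
- move: sB; rewrite last_cat /= => /adjacentP[x0 [y0 [x0s y0B gxy]]].
  by apply: (adjacentI gxy) => //; rewrite inE y0B.
- by rewrite /= ur1.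
- by rewrite /= ur.
- move=> z zur1; rewrite !inE !negb_or B1 ?inE ?mem_cat ?inE; last first.
    by move: zur1; rewrite inE => ->; rewrite !orbT.
  rewrite /=; apply/andP; split; first by move: zur1; apply: contraTneq => ->; rewrite inE negb_or tu.
  by apply/negP => /mq1; rewrite mem_cat zur1 orbT.
- move=> z zur; rewrite !inE !negb_or B2 ?q2E ?inE ?mem_cat ?zur ?orbT //=.
  apply/andP; split; first by move: zur; apply: contraTneq => ->; rewrite inE negb_or tu.
  apply/negP => zm; move: zur; rewrite inE => /predU1P[zu|zr]; first by rewrite -zu zm in um'.
  by move/hasPn: mr => /(_ _ zr); rewrite /= zm.
Qed.

(** Isolated in [e] but adjacent to [a] and [b] in [g], the vertex [v] is the connected set with
    which the rerouting starts. *)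
Lemma conflict_transitive (e : rel T) v a b :
  symmetric e -> subrel e g -> ~ has_minor g K23_rel ->
  (forall x, ~~ e v x) -> v != b -> v != a -> g v a -> g v b ->
  transitive_conn (@sep T) (fun O O' => connect (conflict O O') b a) (orientations e).
Proof.
move=> e_sym eg nK23 nv vb va gva gvb O O1 O2 tO tO1 tO2 s1 s2 _.
case/connectP => p1 bp1 ap1; case/shortenP: bp1 ap1 => q1 bq1 uq1 _ aq1.
case/connectP => p2 bp2 ap2; case/shortenP: bp2 ap2 => q2 bq2 uq2 _ aq2.
have off O' O'' q : O'' \in orientations e -> path (conflict O' O'') b q ->
    {in b :: q, forall z, z \notin [set v]}.
  move=> tO'' bq z; rewrite !inE => /predU1P[->|zq]; first by rewrite eq_sym.
  apply/eqP => zv; rewrite {}zv in zq; have /negP[] := nv (nth v (b :: q) (index v q)).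
  have /pathP - /(_ v (index v q)) := bq; rewrite index_mem => /(_ zq); rewrite nth_index //.
  by case/andP => _; exact: orientation_edge.
rewrite aq1; apply: (@conflict_reroute e O O1 O2 [set v] b q1 q2) => //.
- exact: connected_set1.
- by apply: (@adjacentI b v); rewrite ?inE // g_sym.
- by apply: (@adjacentI a v); rewrite ?inE ?aq1 // -?aq1 g_sym.
- by rewrite -aq1.
- exact: off bq1.
- exact: off bq2.
Qed.
End Minors.

(** * A vertex of low degree *)

Section LowDegree.
Variables (T : finType) (e : rel T).
Hypotheses (e_sym : symmetric e) (e_irr : irreflexive e).

Lemma third_element (N : {set T}) a b : 2 < #|N| -> exists z, [/\ z \in N, z != a & z != b].
Proof.
move=> N3; have: 0 < #|N :\ a :\ b|.
  have := cardsD1 a N; have := cardsD1 b (N :\ a).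
  by case: (_ \in _); case: (_ \in _); lia.
by case/card_gt0P => z; rewrite !inE => /and3P[zb za zN]; exists z.
Qed.

(* Take a longest path [x, t] whose first chord from [x] is as short as possible: the chord ends at [y],
   just after [w].  Going back from [w] to [x] and then on from [y] gives another longest
   path, so all neighbours of [w] lie on it; a neighbour beyond [y] yields [K_4], and
   otherwise [w] has a shorter chord. *)
Lemma low_degree_vertex x0 y0 : ~ has_minor e K4_rel -> e x0 y0 ->
  exists v, 0 < #|[set z | e v z]| <= 2.
Proof.
move=> nK4 exy0; have [/existsP//|/existsPn big] := boolP [exists v, 0 < #|[set z | e v z]| <= 2].
have {}big x y : e x y -> 2 < #|[set z | e x z]|.
  move=> exy; have := big x; rewrite negb_and -ltnNge => /orP[|]; last by rewrite ltnNge.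
  by rewrite ltnS leqn0 cards_eq0 => /eqP/setP/(_ y); rewrite !inE exy.
pose long n := [exists x, exists t : n.-tuple T, path e x t && uniq (x :: t)].
have long1 : exists n, long n.
  exists 1; apply/existsP; exists x0; apply/existsP; exists [tuple y0].
  by rewrite /= exy0 inE /= !andbT; apply: contraTneq exy0 => ->; rewrite e_irr.
have long_le n : long n -> n <= #|T|.
  case/existsP => x /existsP[t /andP[_ ut]].
  have := max_card (mem (x :: t)); rewrite (card_uniqP ut) /= size_tuple; exact: ltnW.
case: (ex_maxnP long1 long_le) => L /existsP[x1 /existsP[t1 /andP[p1 u1]]] maxL.
have L0 : 0 < L.
  apply: maxL; apply/existsP; exists x0; apply/existsP; exists [tuple y0].
  by rewrite /= exy0 inE /= !andbT; apply: contraTneq exy0 => ->; rewrite e_irr.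
have nbr x (t : seq T) z : size t = L -> path e x t -> uniq (x :: t) -> e x z -> z \in t.
  move=> st pt ut exz; apply: contraT => zt.
  have szt : size (x :: t) == L.+1 by rewrite /= st.
  suff /maxL : long L.+1 by rewrite ltnn.
  apply/existsP; exists z; apply/existsP; exists (Tuple szt).
  have /= /andP[xt ut2] := ut; rewrite /= e_sym exz pt inE negb_or zt xt ut2 !andbT.
  by apply: contraTneq exz => ->; rewrite e_irr.
have deg x (t : seq T) : size t = L -> path e x t -> 2 < #|[set z | e x z]|.
  by case: t => [|y t] /= sL; [rewrite -sL in L0|case/andP => /big].
pose chord k := [exists x, exists t : L.-tuple T,
  [&& path e x t, uniq (x :: t), 0 < k < L & e x (nth x t k)]].
have chordI x t z : size t = L -> path e x t -> uniq (x :: t) -> e x z -> z != nth x t 0 ->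
    chord (index z t).
  move=> st pt ut exz zt; have zt' := nbr _ _ _ st pt ut exz.
  have /eqP st' := st; apply/existsP; exists x; apply/existsP; exists (Tuple st') => /=.
  rewrite pt; have /= -> := ut; rewrite nth_index // exz andbT -st index_mem zt' andbT lt0n.
  by apply: contra zt => /eqP i0; rewrite -i0 nth_index.
have chord1 : exists k, chord k.
  have [z [+ zt _]] := third_element (nth x1 t1 0) (nth x1 t1 0) (deg _ _ (size_tuple t1) p1).
  by rewrite inE => x1z; exists (index z t1); apply: chordI zt; rewrite ?size_tuple.
case: (ex_minnP chord1) => k /existsP[x /existsP[t /and4P[pt ut /andP[k0 kL] exy]]] mink.
have st := size_tuple t; set y := nth x t k in exy.
have tE : tval t = take k t ++ y :: drop k.+1 t by rewrite -drop_nth ?st // cat_take_drop.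
set s2 := drop k.+1 t in tE.
(* By minimality of [k], a third neighbour of [x] can only lie beyond [y]; it will make the end of
   the path adjacent to its beginning. *)
have [z [+ zt zy]] := third_element (nth x t 0) y (deg _ _ st pt); rewrite inE => exz.
have szs1 : size (take k t) = k by rewrite size_take st kL.
have zs2 : z \in s2.
  have /mink kz := chordI _ _ _ st pt ut exz zt.
  have := nbr _ _ _ st pt ut exz; rewrite tE mem_cat inE (negPf zy) /= => /orP[zt'|//].
  have : index z (take k t) < k by rewrite -{2}szs1 index_mem.
  move=> lt; suff: index z t < k by rewrite ltnNge kz.
  by rewrite -[tval t](cat_take_drop k) index_cat zt'.
case/lastP: (take k t) tE szs1 => [|s1 w] tE szs1; first by rewrite -szs1 in k0.
rewrite size_rcons in szs1; rewrite tE in pt ut.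
move: (pt); rewrite cat_path rcons_path last_rcons /= => /andP[/andP[ps1 ws1] /andP[wy ys2]].
pose t' := rev (x :: s1) ++ y :: s2.
have ut' : uniq (w :: t').
  rewrite -(perm_uniq (_ : perm_eq (x :: rcons s1 w ++ y :: s2) _)) // /t'.
  apply/permP => a; rewrite /= !count_cat count_rev -cats1 count_cat /=.
  by rewrite addn0 !addnA; congr (_ + _ + _); rewrite addnC addnA.
have pt' : path e w t'.
  rewrite /t' cat_path rev_cons last_rcons /= exy ys2 andbT -rev_cons.
  have := rev_path e x (rcons s1 w); rewrite belast_rcons last_rcons => ->.
  rewrite -(eq_path (e := e)) => [|u v]; last by rewrite /= e_sym.
  by rewrite andbT rcons_path ps1.
have st' : size t' = L.
  by rewrite /t' size_cat size_rev /= szs1 -st tE size_cat size_rcons szs1.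
have [/exists_inP[z' z's2 ewz']|/exists_inPn nws2] := boolP [exists z' in s2, e w z'].
  case: nK4; move: ut; rewrite /= cat_uniq rcons_uniq mem_cat mem_rcons !inE !negb_or /=.
  case/andP=> /and3P[/andP[xw xs1] xy xs2] /and3P[/andP[ws1' us1] + /andP[ys2' us2]].
  rewrite mem_rcons inE negb_or => /andP[/andP[yw ys1] /hasPn s21].
  have {}s21 u : u \in s2 -> (u != w) && (u \notin s1).
    by move=> /s21; rewrite /= mem_rcons inE negb_or.
  have ws2 : w \notin s2 by apply/negP => /s21; rewrite eqxx.
  have [y2 [s2' s2E]] : exists y2 s2', s2 = y2 :: s2'.
    by case: (s2) zs2 => // y2 s2' _; exists y2, s2'.
  (* The branch sets are the path from [x] to just before [w], the vertices [w] and [y], and all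
     that follows [y]. The chord [xy] and the edges [xz] and [wz'] supply the adjacencies not given
     by the path. *)
  apply: (K4_minor e_sym (B0 := [set u in x :: s1]) (B1 := [set w]) (B2 := [set y])
    (B3 := [set u in s2])).
  - exact: connected_set_path.
  - exact: connected_set1.
  - exact: connected_set1.
  - by move: ys2; rewrite s2E => /= /andP[_]; apply: connected_set_path.
  - by rewrite disjoint_sym disjoints1 !inE negb_or eq_sym xw.
  - by rewrite disjoint_sym disjoints1 !inE negb_or eq_sym xy.
  - apply/pred0P => u; rewrite /= !inE; apply/negP => /andP[/predU1P[->|us] us2'].
      by rewrite us2' in xs2.
    by have /andP[_ /negP[]] := s21 _ us2'.
  - by rewrite disjoints1 inE eq_sym.
  - by rewrite disjoints1 inE.
  - by rewrite disjoints1 inE.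
  - by apply: (adjacentI ws1); rewrite !inE // -in_cons mem_last.
  - by apply: (adjacentI exy); rewrite !inE eqxx.
  - by apply: (adjacentI exz); rewrite !inE ?eqxx.
  - by apply: (adjacentI wy); rewrite !inE eqxx.
  - by apply: (adjacentI ewz'); rewrite !inE ?eqxx.
  - by move: ys2; rewrite s2E => /= /andP[yy2 _]; apply: (adjacentI yy2); rewrite !inE eqxx.
have [m [+ my mt']] := third_element y (nth w t' 0) (deg _ _ st' pt'); rewrite inE => ewm.
have mt := nbr _ _ _ st' pt' ut' ewm.
have ms1 : m \in rev (x :: s1).
  move: mt; rewrite mem_cat inE (negPf my) /= => /orP[//|ms2].
  by have := nws2 _ ms2; rewrite ewm.
have /mink := chordI _ _ _ st' pt' ut' ewm mt'; rewrite index_cat ms1 leqNgt.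
have : index m (rev (x :: s1)) < size (rev (x :: s1)) by rewrite index_mem.
by rewrite size_rev /= szs1 => ->.
Qed.
End LowDegree.

(** * Families obstructed by a minor *)

Section AcyclicConflicts.
Variable T : finType.
Implicit Types (r : rel T) (A : {set T * T}).

Lemma connect_avoid_end r x y :
  connect r y x -> connect (fun u v => r u v && (u != x)) y x.
Proof.
case/connectP => p; elim: p y => [y _ ->|z p IH y /= /andP[yz zp] lx]; first exact: connect0.
have [->|yx] := eqVneq y x; first exact: connect0.
by apply: connect_trans (IH _ zp lx); apply: connect1; rewrite yz.
Qed.

(** A return path from [y] to [x], cut at its first visit to [x], avoids the arc from [x] to [y],
    and by asymmetry it avoids the reverse arc. Hence this edge would not be a bridge of [A]. *)
Lemma forest_acyclic r A : is_forest A -> subrel r (undirected A) ->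
  (forall u v, r u v -> ~~ r v u) -> acyclic r.
Proof.
move=> /is_forestP fA rA r_asym; apply/acyclicP => x y rxy; apply/negP => /connect_avoid_end yx.
have sub q : (q == (x, y)) || (q == (y, x)) -> connect (undirected (A :\ q)) y x.
  move=> qxy; apply: connect_sub yx => u v /andP[ruv ux]; apply: connect1.
  have uv1 : (u, v) != (x, y) by apply: contraNneq ux => -[->].
  have uv2 : (u, v) != (y, x).
    by apply/eqP => -[uy vx]; have := r_asym _ _ rxy; rewrite -uy -vx ruv.
  have vu1 : (v, u) != (x, y) by apply: contraNneq uv2 => -[-> ->].
  have vu2 : (v, u) != (y, x) by apply: contraNneq uv1 => -[-> ->].
  have := rA _ _ ruv; rewrite /undirected !in_setD1.
  by case/orP: qxy => /eqP->; rewrite ?uv1 ?uv2 ?vu1 ?vu2.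
have := rA _ _ rxy; rewrite /undirected => /orP[] /[dup] pA /fA /= /negP; apply.
  by rewrite connect_undirected_sym; apply: sub; rewrite eqxx.
by apply: sub; rewrite eqxx orbT.
Qed.

(* Arcs outside [c] raise [R], so a directed cycle stays inside [c]. *)
Lemma acyclic_rank (R : T -> nat) r (c : rel T) :
  (forall x y, r x y -> if c x y then R x = R y else R x < R y) ->
  acyclic (fun x y => r x y && c x y) -> acyclic r.
Proof.
move=> rR /acyclicP ac; apply/acyclicP => x y rxy; apply/negP => yx.
have le u v : r u v -> R u <= R v by move=> /rR; case: ifP => _; [move->|move/ltnW].
have lec u v : connect r u v -> R u <= R v.
  case/connectP => p; elim: p u => [u _ ->|w p IH u /= /andP[/le uw] wp /(IH _ wp)] //.
  exact: leq_trans.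
have inc u v : connect r u v -> R v <= R u -> connect (fun x y => r x y && c x y) u v.
  case/connectP => p; elim: p u => [u _ -> _|w p IH u /= /andP[ruw wp] lv vu]; first exact: connect0.
  have wv : R w <= R v by apply: lec; apply/connectP; exists p.
  apply: connect_trans (IH w wp lv (leq_trans vu (le _ _ ruw))); apply: connect1; rewrite ruw /=.
  by have := rR _ _ ruw; case: ifP => // _; rewrite ltnNge (leq_trans wv).
have cxy : c x y by have := rR _ _ rxy; case: ifP => // _; rewrite ltnNge lec.
by have /negP[] := ac x y (introT andP (conj rxy cxy)); exact: inc yx (le _ _ rxy).
Qed.
End AcyclicConflicts.

Section Obstruction.
Variables (T : finType) (e : rel T) (D : {set T * T}).
Hypotheses (e_sym : symmetric e) (e_irr : irreflexive e) (tD : D \in orientations e).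
Variables (U : finType) (h : rel U) (f : U -> {set T}).
Hypotheses (h_sym : symmetric h) (h_irr : irreflexive h).
Hypothesis f_disj : forall u v, u != v -> [disjoint f u & f v].
Hypothesis f_conn : forall u x y, x \in f u -> y \in f u -> connect (induced e (f u)) x y.
Hypothesis f_adj : forall u v, h u v -> exists x y, [/\ x \in f u, y \in f v & e x y].

Lemma branch_uniq u v x : x \in f u -> x \in f v -> u = v.
Proof.
by move=> xu xv; apply/eqP; apply: contraT => /f_disj/pred0P/(_ x); rewrite /= xu xv.
Qed.

(** [xi u v] and [xi v u] have to be the ends of the same edge. The edges chosen for [(u, v)] and
    [(v, u)] may differ, and the enumeration rank decides which one is used. *)
Lemma branch_ends (t0 : T) : exists xi : U -> U -> T,
  forall u v, h u v -> (xi u v \in f u) && e (xi u v) (xi v u).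
Proof.
have F0 (p : U * U) : exists q : T * T,
    h p.1 p.2 ==> [&& q.1 \in f p.1, q.2 \in f p.2 & e q.1 q.2].
  have [/f_adj[x [y [xu yv exy]]]|_] := boolP (h p.1 p.2); last by exists (t0, t0).
  by exists (x, y); rewrite /= xu yv.
have [F FP] := fin_all_exists F0.
exists (fun u v => if enum_rank u < enum_rank v then (F (u, v)).1 else (F (v, u)).2) => u v huv.
have /implyP/(_ huv)/and3P[/= a b c] := FP (u, v).
have /implyP/=/[1!h_sym]/(_ huv)/and3P[a' b' c'] := FP (v, u).
have [uv|vu|/val_inj/enum_rank_inj uv] := ltngtP (enum_rank u) (enum_rank v); rewrite ?a ?b' //.
  by rewrite e_sym c'.
by rewrite uv h_irr in huv.
Qed.

Definition inner (x y : T) := [exists u, (x \in f u) && (y \in f u)].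

(** A maximal forest among the arcs inside branch sets spans each of them, since any inner arc
    joining two components could be added. *)
Lemma inner_forest : exists A : {set T * T}, [/\ A \subset D, is_forest A,
  forall x y, undirected A x y -> inner x y &
  forall u x y, x \in f u -> y \in f u -> connect (undirected A) x y].
Proof.
pose P (A : {set T * T}) := (A \subset [set p in D | inner p.1 p.2]) && is_forest A.
have P0 : P set0 by rewrite /P sub0set; apply/is_forestP => p; rewrite inE.
have [A /maxsetP[/andP[AD fA] maxA] _] := maxset_exists P0.
have inD p : p \in A -> (p \in D) && inner p.1 p.2 by move/(subsetP AD); rewrite inE.
exists A; split=> //.
- by apply/subsetP => p /inD/andP[].
- by move=> x y /orP[] /inD/andP[_] // /existsP[u /andP[yu xu]]; apply/existsP; exists u; rewrite xu.
move=> u x y xu yu; apply: connect_sub (f_conn xu yu) => a b /and3P[eab au bu].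
wlog abD : a b eab au bu / (a, b) \in D.
  move=> wl; have [|abD] := boolP ((a, b) \in D); first exact: wl.
  by rewrite connect_undirected_sym wl 1?e_sym // (orientation_rev tD).
apply: contraT => nab; have := nab; rewrite connect1 // /undirected.
have <- : (a, b) |: A = A; last by rewrite setU11.
apply: maxA; last exact: subsetUr.
rewrite /P is_forestU1 // subUset AD sub1set inE abD !andbT /=.
by apply/existsP; exists u; rewrite au.
Qed.

Variables (xi : U -> U -> T) (A : {set T * T}).
Hypothesis xiP : forall u v, h u v -> (xi u v \in f u) && e (xi u v) (xi v u).
Hypotheses (AD : A \subset D) (fA : is_forest A).
Hypothesis A_inner : forall x y, undirected A x y -> inner x y.
Hypothesis A_conn : forall u x y, x \in f u -> y \in f u -> connect (undirected A) x y.

Definition link u v := (xi u v, xi v u).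

Lemma link_edge u v : h u v -> e (xi u v) (xi v u).
Proof. by move/xiP/andP => []. Qed.

Lemma link_branch u v : h u v -> xi u v \in f u.
Proof. by move/xiP/andP => []. Qed.

Lemma link_inj u v u' v' : h u v -> h u' v' -> link u v = link u' v' -> u = u' /\ v = v'.
Proof.
move=> huv hu'v' [E1 E2]; split.
  by apply: (branch_uniq (link_branch huv)); rewrite E1 link_branch.
rewrite (h_sym u) in huv; rewrite (h_sym u') in hu'v'.
by apply: (branch_uniq (link_branch huv)); rewrite E2 link_branch.
Qed.

Lemma link_not_inner u v : h u v -> ~~ inner (xi u v) (xi v u).
Proof.
move=> huv; apply/existsP => -[w /andP[uw vw]].
have uw' := branch_uniq (link_branch huv) uw; rewrite h_sym in huv.
by have vw' := branch_uniq (link_branch huv) vw; rewrite uw' vw' h_irr in huv.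
Qed.


Variable tl : seq (U * U).
(* [tl] builds a tree by attaching a new leaf [u] to [v] for each entry [(u, v)], last entry first. *)
Fixpoint leaf_list (l : seq (U * U)) :=
  if l is (u, v) :: l' then
    [&& h u v, all (fun p => (u != p.1) && (u != p.2)) l' & leaf_list l']
  else true.
Hypothesis tl_leaf : leaf_list tl.

Definition tree_edge u v := ((u, v) \in tl) || ((v, u) \in tl).

Definition lifted_tree := [set p in D | undirected A p.1 p.2 ||
  [exists u, exists v, tree_edge u v && (p == link u v)]].

(** The link attaching a leaf [u] is a bridge, because no arc collected before it leaves [f u]. *)
Lemma lifted_tree_forest : lifted_tree \in forests D.
Proof.
have subD : lifted_tree \subset D by apply/subsetP => p; rewrite inE => /andP[].
rewrite !inE subD /=.
pose dir p : T * T := if p \in D then p else (p.2, p.1).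
pose L l := A :|: [set p in [seq dir (link q.1 q.2) | q <- l]].
have hl l : leaf_list l -> forall q, q \in l -> h q.1 q.2.
  elim: l => // -[u v] l IH /= /and3P[huv _ /IH hl] q; rewrite inE => /predU1P[->//|]; exact: hl.
apply: (@is_forest_subset _ (L tl)).
  apply/subsetP => -[x y]; rewrite !inE /= => /andP[xyD /orP[/orP[->//|yxA]|]].
    by have := orientation_asym tD xyD; rewrite (subsetP AD).
  case/existsP => u /existsP[v /andP[uv /eqP E]]; apply/orP; right; apply/mapP.
  case/orP: uv => uvl; first by exists (u, v); rewrite // /dir -E xyD.
  have linkE : link v u = (y, x) by case: E => -> ->.
  exists (v, u) => //; rewrite /dir.
  by rewrite linkE /= (negPf (orientation_asym tD xyD)).
elim: (tl) tl_leaf (hl _ tl_leaf) => [_ _|[u v] l IH /= /and3P[huv ul ll] hul].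
  by rewrite (_ : L [::] = A) //; apply/setP => p; rewrite !inE orbF.
have {}IH := IH ll (hl _ ll).
have LE : L ((u, v) :: l) = dir (link u v) |: L l.
  by apply/setP => p; rewrite !inE orbCA.
have uf : closed (undirected (L l)) [pred z | z \in f u].
  apply: intro_closed; first exact: sym_connect_sym (@undirected_sym _ _).
  suff st x y : (x, y) \in L l -> (x \in f u) = (y \in f u).
    by move=> x y /orP[] /st; rewrite !inE => ->.
  rewrite !inE => /orP[xyA|/mapP[[u' v'] q']].
    have : undirected A x y by rewrite /undirected xyA.
    case/A_inner/existsP => w /andP[xw yw].
    by apply/idP/idP => [/(branch_uniq xw)<-|/(branch_uniq yw)<-].
  have hq := hl _ ll _ q'; have /andP[u'u v'u] := allP ul _ q'; rewrite /= in hq u'u v'u.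
  have xf : xi u' v' \notin f u.
    by apply: contra u'u => xu; rewrite (branch_uniq xu (link_branch hq)).
  have yf : xi v' u' \notin f u.
    by apply: contra v'u => xu; rewrite h_sym in hq; rewrite (branch_uniq xu (link_branch hq)).
  by rewrite /dir; case: ifP => _ [-> ->]; rewrite (negPf xf) (negPf yf).
have nc : ~~ connect (undirected (L l)) (xi u v) (xi v u).
  apply: contra (link_not_inner huv) => /(closed_connect uf); rewrite !inE link_branch // => vu.
  by apply/existsP; exists u; rewrite link_branch.
rewrite LE /dir; case: ifP => _; apply: is_forestU1 => //.
by rewrite connect_undirected_sym.
Qed.

Variables (J : finType) (om : J -> rel U) (rho : J -> J -> U -> nat).
Hypothesis om_h : forall j u v, om j u v -> h u v.
Hypothesis om_rev : forall j u v, h u v -> om j v u = ~~ om j u v.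
Hypothesis om_rho : forall i j u v, om i u v -> om j v u -> rho i j u < rho i j v.
(** Here [tau] describes an orientation that may be reoriented freely along the tree. Tree edges
    count as conflicts because they can be turned against [om j]. *)
Hypothesis om_block : forall tau : rel U, (forall u v, h u v -> tau v u = ~~ tau u v) ->
  exists j, ~~ acyclic (fun u v => om j u v && (tree_edge u v || tau v u)).

Definition is_link p := [exists u, exists v, h u v && (p == link u v)].

(** The directions on [A] are left free because a cycle of the minor crosses the branch sets along
    [A] in directions that are not known beforehand. *)
Definition obstruction : {set {set T * T}} := [set O in orientations e | [exists j,
  [forall u, forall v, om j u v ==> (link u v \in O)] &&
  [forall p in D, ~~ undirected A p.1 p.2 && ~~ is_link p ==> (p \in O)]]].

Lemma is_linkC x y : is_link (x, y) = is_link (y, x).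
Proof.
suff imp a b : is_link (a, b) -> is_link (b, a) by apply/idP/idP; exact: imp.
case/existsP => u /existsP[v /andP[huv /eqP[-> ->]]].
by apply/existsP; exists v; apply/existsP; exists u; rewrite h_sym huv eqxx.
Qed.

(** Off [A] two members can differ only on links, and a conflict on a link raises the rank attached
    to the branch sets. Along [A] this rank is constant, and there the conflict is acyclic as it
    lives on a forest. *)
Lemma obstruction_sep : {in obstruction &, forall O O', sep O O'}.
Proof.
move=> O1 O2; rewrite !inE => /andP[t1 /existsP[i /andP[/forallP li /forall_inP ri]]].
case/andP=> t2 /existsP[j /andP[/forallP lj /forall_inP rj]].
have {}t1 : O1 \in orientations e by rewrite inE.
have {}t2 : O2 \in orientations e by rewrite inE.
have {}li u v : om i u v -> link u v \in O1 by have /forallP/(_ v)/implyP := li u.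
have {}lj u v : om j u v -> link u v \in O2 by have /forallP/(_ v)/implyP := lj u.
pose R x := if [pick u | x \in f u] is Some u then rho i j u else 0.
have RE u x : x \in f u -> R x = rho i j u.
  move=> xu; rewrite /R; case: pickP => [v xv|/(_ u)]; last by rewrite xu.
  by rewrite (branch_uniq xu xv).
apply: (@acyclic_rank _ R _ (undirected A)) => [x y cxy|]; last first.
  apply: (forest_acyclic fA) => [u v /andP[]//|u v /andP[/(conflict_asym t1) uv _]].
  by rewrite negb_and uv.
have /andP[xyO1 yxO2] := cxy; have exy := orientation_edge t1 xyO1.
case: ifP => [/A_inner/existsP[u /andP[xu yu]]|nA]; first by rewrite (RE _ _ xu) (RE _ _ yu).
have [|nl] := boolP (is_link (x, y)).
  case/existsP => u /existsP[v /andP[huv /eqP[xE yE]]]; have hvu := huv; rewrite h_sym in hvu.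
  have iuv : om i u v.
    rewrite -[om i u v]negbK -om_rev //; apply/negP => /li; rewrite /link -xE -yE.
    by apply/negP; apply: orientation_asym t1 xyO1.
  have jvu : om j v u.
    rewrite om_rev //; apply/negP => /lj; rewrite /link -xE -yE.
    by apply/negP; apply: orientation_asym t2 yxO2.
  by rewrite xE yE (RE u) ?(RE v) ?link_branch // om_rho.
have [xyD|xyD] := boolP ((x, y) \in D).
  have /implyP := rj _ xyD; rewrite nA nl => /(_ isT).
  by rewrite (negPf (orientation_asym t2 yxO2)).
have yxD : (y, x) \in D by rewrite (orientation_rev tD).
have /implyP := ri _ yxD; rewrite is_linkC nl undirected_sym nA => /(_ isT).
by rewrite (negPf (orientation_asym t1 xyO1)).
Qed.

Let mk (dec : rel T) : {set T * T} := reorient D [set p in D | dec p.1 p.2].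

Let mk_orientation dec : mk dec \in orientations e.
Proof. by apply: reorient_orientation => //; apply/subsetP => p; rewrite inE => /andP[]. Qed.

Let mkE (dec : rel T) x y : e x y -> dec y x = ~~ dec x y -> ((x, y) \in mk dec) = dec x y.
Proof.
move=> exy dyx; rewrite /mk mem_reorient !inE /= (orientation_rev tD) 1?e_sym //.
by rewrite dyx; case: ((y, x) \in D); case: (dec x y).
Qed.

Let mkD (dec : rel T) p : p \in D -> (p \in mk dec) = dec p.1 p.2.
Proof.
case: p => x y xyD; rewrite /mk mem_reorient !inE /= xyD.
by rewrite (negPf (orientation_asym tD xyD)) andbF orbF.
Qed.

(** With equality, all reorientations of some [O] along the lifted tree lie in [S]. Applied to the
    links of [O], [om_block] yields a directed cycle of the minor, which lifts through [A]. A member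
    of the obstruction follows the lifted cycle and a reorientation of [O] reverses it, so these two
    members of [S] are not separated. *)
Lemma obstruction_blocks (S : {set {set T * T}}) :
  S \subset orientations e -> {in S &, forall O O', sep O O'} -> obstruction \subset S ->
  #|S| <> #|forests D|.
Proof.
move=> St Ss obS cS.
have [O [tO OS]] := extremal_reorientations e_sym tD St Ss cS lifted_tree_forest.
have h_e u v : h u v -> (link v u \in O) = (link u v \notin O).
  by move=> huv; rewrite (orientation_rev tO) // link_edge.
have [j] := om_block h_e; set C := (fun u v => _) => nC.
have [u0 [v0 [Cuv vu]]] : exists u v, C u v /\ connect C v u.
  move: nC; rewrite negb_forall => /existsP[u]; rewrite negb_forall => /existsP[v].
  by rewrite negb_imply negbK => /andP[]; exists u, v.
have Ch u v : C u v -> h u v by case/andP => /om_h.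
pose t x y := undirected A x y || [exists u, exists v, C u v && ((x, y) == link u v)].
have tC u v : C u v -> t (xi u v) (xi v u).
  by move=> cuv; apply/orP; right; apply/existsP; exists u; apply/existsP; exists v; rewrite cuv eqxx.
have conn_branch u x y : x \in f u -> y \in f u -> connect t x y.
  move=> xu yu; apply: connect_sub (A_conn xu yu) => a b ab; apply: connect1.
  by rewrite /t ab.
have conn_C u v x y : connect C u v -> x \in f u -> y \in f v -> connect t x y.
  case/connectP => p; elim: p u x => [u x _ ->|w p IH u x /= /andP[uw wp] lv xu yv].
    exact: conn_branch.
  have huw := Ch _ _ uw; have hwu := huw; rewrite h_sym in hwu.
  apply: connect_trans (conn_branch _ _ _ xu (link_branch huw)) _.
  apply: connect_trans (connect1 (tC _ _ uw)) _.
  exact: IH wp lv (link_branch hwu) yv.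
have huv0 := Ch _ _ Cuv; have hvu0 := huv0; rewrite h_sym in hvu0.
have [i] := increasing_path (conn_C _ _ _ _ vu (link_branch hvu0) (link_branch huv0)).
set ti := (fun x y => _) => yx.
pose dir (k : rel U) x y := [exists u, exists v, k u v && ((x, y) == link u v)].
have dirE (k : rel U) u v : (forall a b, k a b -> h a b) -> h u v ->
    dir k (xi u v) (xi v u) = k u v.
  move=> kh huv; apply/existsP/idP => [[a /existsP[b /andP[kab /eqP E]]]|kuv]; last first.
    by exists u; apply/existsP; exists v; rewrite kuv eqxx.
  by have [-> ->] := link_inj huv (kh _ _ kab) E.
(* [d2] gives the member of the obstruction, rising along the lifted path inside [A]; [d1] gives the
   reorientation of [O], falling inside [A] and opposed to [om j] on the tree links. *)
pose d2 x y := if undirected A x y then i x < i y else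
  if is_link (x, y) then dir (om j) x y else true.
pose treeC u v := tree_edge u v && om j v u.
pose d1 x y := if undirected A x y then i y < i x else
  if dir tree_edge x y then dir treeC x y else (x, y) \in O.
have tree_h u v : tree_edge u v -> h u v.
  have hl l : leaf_list l -> forall q, q \in l -> h q.1 q.2.
    elim: l => // -[a b] l IH /= /and3P[hab _ /IH hl] q; rewrite inE => /predU1P[->//|]; exact: hl.
  by case/orP => /(hl _ tl_leaf) //=; rewrite h_sym.
have treeC_h u v : treeC u v -> h u v by case/andP => /tree_h.
have tree_sym u v : tree_edge u v = tree_edge v u by rewrite /tree_edge orbC.
have linkA u v : h u v -> undirected A (xi u v) (xi v u) = false.
  by move=> huv; apply: contraNF (link_not_inner huv) => /A_inner.
have linkL u v : h u v -> is_link (link u v).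
  by move=> huv; apply/existsP; exists u; apply/existsP; exists v; rewrite huv eqxx.
have d2E u v : h u v -> d2 (xi u v) (xi v u) = om j u v.
  by move=> huv; rewrite /d2 linkA // linkL // dirE //; apply: om_h.
have d1E u v : h u v ->
    d1 (xi u v) (xi v u) = if tree_edge u v then om j v u else link u v \in O.
  by move=> huv; rewrite /d1 linkA // !dirE // /treeC; case: ifP => [->|].
have O2S : mk d2 \in S.
  apply: (subsetP obS); rewrite in_set mk_orientation; apply/existsP; exists j; apply/andP; split.
    apply/forallP => u; apply/forallP => v; apply/implyP => uv; have huv := om_h uv.
    have hvu := huv; rewrite h_sym in hvu.
    by rewrite mkE ?link_edge // !d2E // -om_rev // om_rev.
  apply/forall_inP => -[x y] xyD; apply/implyP => /andP[nA nl].
  by rewrite mkD // /d2 (negPf nA) (negPf nl).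
have O1S : mk d1 \in S.
  apply: OS; first exact: mk_orientation.
  move=> [x y]; rewrite in_setD inE => /andP[+ xyD]; rewrite xyD negb_or => /andP[nA nt].
  have nt0 : dir tree_edge x y = false := negPf nt.
  by rewrite mkD // /d1 (negPf nA) nt0.
have eA x y : undirected A x y -> e x y.
  by case/orP => /(subsetP AD)/(orientation_edge tD); rewrite // e_sym.
have cC u v : C u v -> conflict (mk d2) (mk d1) (xi u v) (xi v u).
  move=> cuv; have huv := Ch _ _ cuv; have hvu := huv; rewrite h_sym in hvu.
  have /andP[juv tuv] := cuv; have jvu : om j v u = false by rewrite om_rev ?juv.
  rewrite /conflict !mkE ?link_edge ?d2E ?d1E ?juv ?jvu //.
    by rewrite tree_sym; case: ifP tuv.
  by rewrite tree_sym; case: ifP => _; rewrite ?juv ?jvu // h_e // negbK.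
have /acyclicP/(_ _ _ (cC _ _ Cuv))/negP[] := Ss _ _ O2S O1S.
apply: connect_sub yx => x y /andP[/orP[xyA|/existsP[u /existsP[v /andP[cuv /eqP[-> ->]]]]] ixy];
  apply: connect1; last exact: cC.
have yxA : undirected A y x by rewrite undirected_sym.
have lt : i y < i x = false by rewrite ltnNge ltnW.
by rewrite /conflict !mkE ?eA // /d1 /d2 xyA yxA ?ixy ?lt.
Qed.
End Obstruction.

Lemma acyclic_triangle (T : finType) (r : rel T) x y z : r x y -> r y z -> r z x -> ~~ acyclic r.
Proof.
move=> xy yz zx; apply/negP => /acyclicP/(_ _ _ xy)/negP; apply.
exact: connect_trans (connect1 yz) (connect1 zx).
Qed.

Lemma acyclic_square (T : finType) (r : rel T) x y z t :
  r x y -> r y z -> r z t -> r t x -> ~~ acyclic r.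
Proof.
move=> xy yz zt tx; apply/negP => /acyclicP/(_ _ _ xy)/negP; apply.
exact: connect_trans (connect1 yz) (connect_trans (connect1 zt) (connect1 tx)).
Qed.

(* [W] lists orientations of the minor [h], [H] its arcs and [Rho] the ranks proving
   that the orientations in [W] are pairwise separated, all on vertices coded as natural numbers. *)
Section Tables.
Variables (U : finType) (h : rel U) (code : U -> nat) (H : seq (nat * nat)).
Variables (W : seq (seq (nat * nat))) (Rho : seq (seq (seq nat))) (tl : seq (U * U)).
Hypothesis hE : forall u v, h u v = ((code u, code v) \in H).

Definition table_om (j : 'I_(size W)) : rel U :=
  fun u v => (code u, code v) \in nth [::] W j.

Definition tables_ok :=
  [&& all (fun p => (p.1 != p.2) && ((p.2, p.1) \in H)) H,
      all (fun w => all (mem H) w && all (fun p => ((p.2, p.1) \in w) == (p \notin w)) H) W &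
      all (fun i => all (fun j => all (fun p => ((p.2, p.1) \in nth [::] W j) ==>
        (nth 0 (nth [::] (nth [::] Rho i) j) p.1 < nth 0 (nth [::] (nth [::] Rho i) j) p.2))
        (nth [::] W i)) (iota 0 (size W))) (iota 0 (size W))].

Lemma tables_obstruction (T : finType) (e : rel T) D :
  tables_ok -> leaf_list h tl ->
  (forall tau : rel U, (forall u v, h u v -> tau v u = ~~ tau u v) ->
     exists j, ~~ acyclic (fun u v => table_om j u v && (tree_edge tl u v || tau v u))) ->
  symmetric e -> irreflexive e -> D \in orientations e -> (exists u v, h u v) -> has_minor e h ->
  exists2 S, maximal_family (orientations e) (@sep T) S & #|S| <> #|forests D|.
Proof.
move=> /and3P[/allP Hok /allP Wok /allP Rok] ll block e_sym e_irr tD [u0 [v0 h0]].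
case=> f [f0 f_disj f_conn f_adj].
have h_sym : symmetric h.
  suff imp u v : h u v -> h v u by move=> u v; apply/idP/idP; exact: imp.
  by rewrite !hE => /Hok/andP[].
have h_irr : irreflexive h by move=> u; rewrite hE; apply/negP => /Hok/andP[/eqP].
have [t0 [t1 [_ _ _]]] := f_adj _ _ h0.
have [xi xiP] := branch_ends e_sym h_sym h_irr f_adj t0.
have [A [AD fA A_inner A_conn]] := inner_forest e_sym tD f_conn.
have Wj (j : 'I_(size W)) : nth [::] W j \in W by rewrite mem_nth.
have om_h j u v : table_om j u v -> h u v.
  by rewrite /table_om hE => uv; have /andP[/allP/(_ _ uv)] := Wok _ (Wj j).
have om_rev j u v : h u v -> table_om j v u = ~~ table_om j u v.
  by rewrite /table_om hE => uv; have /andP[_ /allP/(_ _ uv)/eqP] := Wok _ (Wj j).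
pose rho (i j : 'I_(size W)) u := nth 0 (nth [::] (nth [::] Rho i) j) (code u).
have om_rho i j u v : table_om i u v -> table_om j v u -> rho i j u < rho i j v.
  have io (k : 'I_(size W)) : (k : nat) \in iota 0 (size W) by rewrite mem_iota /= ltn_ord.
  by move=> uv vu; have /allP/(_ _ (io j))/allP/(_ _ uv)/implyP/(_ vu) := Rok _ (io i).
set ob := obstruction e D h xi A table_om.
have obS : {in ob &, forall O O', sep O O'}.
  exact: (obstruction_sep tD h_sym f_disj xiP fA A_inner om_rev om_rho).
have obt : ob \subset orientations e by apply/subsetP => O; rewrite inE => /andP[].
have [S obS' maxS] : exists2 S : {set {set T * T}}, ob \subset S &
    maximal_family (orientations e) (@sep T) S.
  apply: extend_family => //; last exact: sepC.
  by move=> O tO; apply: (sep_refl tO).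
exists S => //; case: maxS => St Ss _.
exact: (obstruction_blocks e_sym tD h_sym h_irr f_disj xiP AD fA A_inner A_conn ll om_h om_rev block
  St Ss obS').
Qed.
End Tables.

Definition K4_arcs : seq (nat * nat) :=
  [seq p <- [seq (x, y) | x <- iota 0 4, y <- iota 0 4] | p.1 != p.2].
(** Each entry orients one triangle cyclically and makes the fourth vertex a source or a sink. A
    triangle through [3] has a single edge off the star at [3], so it is blocked if [tau] reverses
    that edge. If [tau] reverses none of these three edges, it contains the directed triangle
    through [0], [1], [2] in this order, which is the reverse of the one in the first entry. *)
Definition K4_orientations : seq (seq (nat * nat)) :=
  [:: [:: (0, 2); (1, 0); (2, 1); (3, 0); (3, 1); (3, 2)];
      [:: (0, 1); (0, 3); (2, 0); (2, 1); (3, 1); (3, 2)];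
      [:: (0, 1); (0, 2); (1, 2); (1, 3); (3, 0); (3, 2)];
      [:: (1, 0); (1, 2); (2, 0); (2, 3); (3, 0); (3, 1)]].
Definition K4_ranks : seq (seq (seq nat)) :=
  [:: [:: [:: 0; 0; 0; 0]; [:: 1; 0; 2; 0]; [:: 2; 1; 0; 0]; [:: 0; 2; 1; 0]];
      [:: [:: 1; 2; 0; 2]; [:: 0; 0; 0; 0]; [:: 1; 3; 0; 2]; [:: 0; 3; 2; 1]];
      [:: [:: 0; 1; 2; 2]; [:: 2; 0; 3; 1]; [:: 0; 0; 0; 0]; [:: 0; 1; 3; 2]];
      [:: [:: 2; 0; 1; 2]; [:: 3; 0; 1; 2]; [:: 3; 2; 0; 1]; [:: 0; 0; 0; 0]]].

Definition K4_star : seq ('I_4 * 'I_4) :=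
  [:: (@Ordinal 4 0 isT, @Ordinal 4 3 isT); (@Ordinal 4 1 isT, @Ordinal 4 3 isT) ;
      (@Ordinal 4 2 isT, @Ordinal 4 3 isT)].

Section NonOuterplanar.
Variables (T : finType) (e : rel T) (D : {set T * T}).
Hypotheses (e_sym : symmetric e) (e_irr : irreflexive e) (tD : D \in orientations e).

Lemma K4_obstruction : has_minor e K4_rel ->
  exists2 S, maximal_family (orientations e) (@sep T) S & #|S| <> #|forests D|.
Proof.
pose o k (k4 : k < 4) : 'I_4 := Ordinal k4; pose j k (k4 : k < size K4_orientations) := Ordinal k4.
apply: (@tables_obstruction _ K4_rel (@nat_of_ord 4) K4_arcs K4_orientations K4_ranks K4_star) => //.
- by case=> [[|[|[|[|u]]]] Hu] // [[|[|[|[|v]]]] Hv].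
- move=> tau tauC; have rev u v : ~~ tau u v -> K4_rel u v -> tau v u by move=> + /tauC ->.
  have [t21|/rev/(_ isT) t12] := boolP (tau (o 2 isT) (o 1 isT)).
    exists (j 3 isT); apply: (@acyclic_triangle _ _ (o 1 isT) (o 2 isT) (o 3 isT)) => //=.
  have [t10|/rev/(_ isT) t01] := boolP (tau (o 1 isT) (o 0 isT)).
    exists (j 2 isT); apply: (@acyclic_triangle _ _ (o 0 isT) (o 1 isT) (o 3 isT)) => //=.
  have [t02|/rev/(_ isT) t20] := boolP (tau (o 0 isT) (o 2 isT)).
    exists (j 1 isT); apply: (@acyclic_triangle _ _ (o 0 isT) (o 3 isT) (o 2 isT)) => //=.
  by exists (j 0 isT); apply: (@acyclic_triangle _ _ (o 0 isT) (o 2 isT) (o 1 isT)) => //=.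
- by exists (o 0 isT), (o 1 isT).
Qed.

Definition K23_arcs : seq (nat * nat) :=
  [seq (x, y) | x <- iota 0 2, y <- iota 2 3] ++ [seq (y, x) | x <- iota 0 2, y <- iota 2 3].
(** Each entry orients a four-cycle through the hubs [0], [1] cyclically and makes the remaining
    vertex a source. The tree used with it misses only the edges from [1] to [3] and to [4]. The
    first entry is blocked if [tau] directs [1] to [3], the second if it directs [4] to [1];
    otherwise [tau] reverses both edges in the third. *)
Definition K23_orientations : seq (seq (nat * nat)) :=
  [:: [:: (1, 2); (2, 0); (0, 3); (3, 1); (4, 0); (4, 1)];
      [:: (0, 2); (2, 1); (3, 0); (3, 1); (1, 4); (4, 0)];
      [:: (2, 0); (2, 1); (1, 3); (3, 0); (0, 4); (4, 1)]].
Definition K23_ranks : seq (seq (seq nat)) :=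
  [:: [:: [:: 0; 0; 0; 0; 0]; [:: 3; 1; 2; 4; 0]; [:: 1; 3; 4; 2; 0]];
      [:: [:: 1; 3; 2; 0; 4]; [:: 0; 0; 0; 0; 0]; [:: 3; 1; 4; 0; 2]];
      [:: [:: 3; 1; 0; 2; 4]; [:: 1; 3; 0; 4; 2]; [:: 0; 0; 0; 0; 0]]].
Definition K23_code (u : 'I_2 + 'I_3) : nat :=
  match u with inl i => i | inr i => i.+2 end.

Let hub k (k2 : k < 2) : 'I_2 + 'I_3 := inl (Ordinal k2).
Let mid k (k3 : k < 3) : 'I_2 + 'I_3 := inr (Ordinal k3).
Let K23_tree := [:: (@hub 1 isT, @mid 0 isT); (@mid 0 isT, @hub 0 isT);
  (@mid 1 isT, @hub 0 isT); (@mid 2 isT, @hub 0 isT)].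

Lemma K23_obstruction : has_minor e K23_rel ->
  exists2 S, maximal_family (orientations e) (@sep T) S & #|S| <> #|forests D|.
Proof.
pose j k (k3 : k < size K23_orientations) := Ordinal k3.
apply: (@tables_obstruction _ K23_rel K23_code K23_arcs K23_orientations K23_ranks K23_tree) => //.
- by case=> [[[|[|u]] Hu]|[[|[|[|u]]] Hu]] // [[[|[|v]] Hv]|[[|[|[|v]]] Hv]].
- move=> tau tauC; have rev u v : ~~ tau u v -> K23_rel u v -> tau v u by move=> + /tauC ->.
  have [t13|/rev/(_ isT) t31] := boolP (tau (@hub 1 isT) (@mid 1 isT)).
    exists (j 0 isT).
    apply: (@acyclic_square _ _ (@hub 0 isT) (@mid 1 isT) (@hub 1 isT) (@mid 0 isT)) => //=.
  have [t41|/rev/(_ isT) t14] := boolP (tau (@mid 2 isT) (@hub 1 isT)).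
    exists (j 1 isT).
    apply: (@acyclic_square _ _ (@hub 0 isT) (@mid 0 isT) (@hub 1 isT) (@mid 2 isT)) => //=.
  exists (j 2 isT).
  apply: (@acyclic_square _ _ (@hub 1 isT) (@mid 1 isT) (@hub 0 isT) (@mid 2 isT)) => //=.
- by exists (@hub 0 isT), (@mid 0 isT).
Qed.
End NonOuterplanar.

(** * Adding edges and paths *)

Section EdgeAddition.
Variable T : finType.
Implicit Types (e : rel T) (O : {set T * T}) (a b v : T).

Definition add_edge e a b : rel T := fun x y => [|| e x y, (x == a) && (y == b) | (x == b) && (y == a)].
Definition delete_edge e a b : rel T :=
  fun x y => e x y && ~~ ((x == a) && (y == b)) && ~~ ((x == b) && (y == a)).
Definition delete_vertex e v : rel T := fun x y => [&& e x y, x != v & y != v].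

Definition arc a b (x : bool) := if x then (a, b) else (b, a).
Definition add_oriented a b (p : {set T * T} * bool) := arc a b p.2 |: p.1.

Lemma eq_orientations e e' : e =2 e' -> orientations e = orientations e'.
Proof.
move=> ee'; apply/setP => O; rewrite !inE; apply: eq_forallb => x; apply: eq_forallb => y.
by rewrite ee'.
Qed.

Lemma add_edge_sym e a b : symmetric e -> symmetric (add_edge e a b).
Proof.
move=> e_sym x y; rewrite /add_edge e_sym [(x == b) && _]andbC [(x == a) && _]andbC.
by rewrite [_ && _ || _]orbC.
Qed.

Section OneEdge.
Variables (e : rel T) (a b : T).
Hypotheses (e_sym : symmetric e) (ab : a != b) (nab : ~~ e a b).

Lemma arc_notin O x : O \in orientations e -> arc a b x \notin O.
Proof.
move=> tO; apply/negP; case: x => /(orientation_edge tO); first by rewrite (negPf nab).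
by rewrite e_sym (negPf nab).
Qed.

Lemma orientations_add_edge :
  orientations (add_edge e a b) = add_oriented a b @: setX (orientations e) [set: bool].
Proof.
have nba : ~~ e b a by rewrite e_sym.
have ba : b != a by rewrite eq_sym.
apply/setP => O; apply/idP/imsetP => [tO|[[O0 x] + ->]]; last first.
  rewrite in_setX in_setT andbT => /= tO0; apply/orientationsP; split=> [[u v]|u v].
    rewrite in_setU1 /add_edge => /orP[|/(orientation_edge tO0)->//].
    by case: (x) => /eqP[-> ->]; rewrite !eqxx ?orbT.
  have [x1 x2] : arc a b true \notin O0 /\ arc a b false \notin O0 by split; apply: arc_notin.
  rewrite /add_edge /add_oriented !in_setU1 /=.
  case/or3P => [euv|/andP[/eqP-> /eqP->]|/andP[/eqP-> /eqP->]].
  - have uva : (u, v) != arc a b x.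
      by apply/eqP => uvE; case: (x) uvE => -[ua vb]; rewrite ua vb ?(negPf nab) ?(negPf nba) in euv.
    have vua : (v, u) != arc a b x.
      by apply/eqP => uvE; case: (x) uvE => -[ua vb]; rewrite ua vb ?(negPf nab) ?(negPf nba) in euv.
    rewrite (negPf uva) (negPf vua) /=; have := orientation_rev tO0 euv; move=> ->.
    by case: (_ \in O0).
  - by move: x1 x2 => /= /negPf-> /negPf->; case: (x); rewrite !xpair_eqE !eqxx ?(negPf ab) ?(negPf ba).
  - by move: x1 x2 => /= /negPf-> /negPf->; case: (x); rewrite !xpair_eqE !eqxx ?(negPf ab) ?(negPf ba).
have eab : add_edge e a b a b by rewrite /add_edge !eqxx orbT.
exists (O :\ (a, b) :\ (b, a), (a, b) \in O).
  rewrite in_setX in_setT andbT; apply/orientationsP; split=> [[u v]|u v euv].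
    rewrite !inE !xpair_eqE => /and3P[/negPf vu /negPf uv /(orientation_edge tO)].
    by rewrite /add_edge uv vu !orbF.
  have nuv (c d u' v' : T) : ~~ e c d -> e u' v' -> ((u', v') == (c, d)) = false.
    by move=> ncd; apply: contraTF => /eqP[-> ->].
  have evu : e v u by rewrite e_sym.
  rewrite !inE !nuv //=; have euv' : add_edge e a b u v by rewrite /add_edge euv.
  by rewrite (orientation_rev tO euv'); case: (_ \in O).
apply/setP => p; rewrite /add_oriented !inE /=; have baE := orientation_rev tO eab.
have [->|pab] := eqVneq p (a, b).
  by rewrite xpair_eqE (negPf ab) /=; case: ((a, b) \in O) => /=; rewrite ?eqxx // xpair_eqE (negPf ab).
have [->|pba] := eqVneq p (b, a).
  by rewrite baE; case: ((a, b) \in O) => /=; rewrite ?eqxx // xpair_eqE (negPf ba).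
by case: ((a, b) \in O) => /=; rewrite ?(negPf pab) ?(negPf pba).
Qed.

Lemma add_oriented_inj : {in setX (orientations e) [set: bool] &, injective (add_oriented a b)}.
Proof.
move=> [O x] [O' x']; rewrite !in_setX !in_setT !andbT /= => tO tO' /setP E.
have ba : b != a by rewrite eq_sym.
have xE : x = x'.
  have := E (a, b); rewrite /add_oriented !in_setU1 /=.
  rewrite (negPf (@arc_notin _ true tO)) (negPf (@arc_notin _ true tO')) !orbF.
  by case: (x); case: (x'); rewrite //= ?eqxx ?xpair_eqE ?(negPf ab).
rewrite -xE in E *; congr (_, _); apply/setP => p; have := E p; rewrite !in_setU1.
by have [->|] //= := eqVneq p (arc a b x); rewrite (negPf (arc_notin _ tO)) (negPf (arc_notin _ tO')).
Qed.

Lemma conflict_add_oriented O O' x x' : O \in orientations e -> O' \in orientations e ->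
  conflict (add_oriented a b (O, x)) (add_oriented a b (O', x')) =2
  if x == x' then conflict O O' else add_arc (conflict O O') (arc a b x).1 (arc a b x).2.
Proof.
move=> tO tO' u v; rewrite /conflict /add_oriented !in_setU1 /=.
have ba : b != a by rewrite eq_sym.
have [/negPf nt /negPf nf] : (a, b) \notin O /\ (b, a) \notin O.
  by split; [exact: (@arc_notin _ true)|exact: (@arc_notin _ false)].
have [/negPf nt' /negPf nf'] : (a, b) \notin O' /\ (b, a) \notin O'.
  by split; [exact: (@arc_notin _ true)|exact: (@arc_notin _ false)].
have [[-> ->]|uvt] := eqVneq (u, v) (a, b).
  rewrite nt nf' !orbF; case: x; case: x';
    by rewrite /= /add_arc ?xpair_eqE ?eqxx ?(negPf ab) ?(negPf ba) /= ?nt ?nf.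
have [[-> ->]|uvf] := eqVneq (u, v) (b, a).
  rewrite nf nt' !orbF; case: x; case: x';
    by rewrite /= /add_arc ?xpair_eqE ?eqxx ?(negPf ab) ?(negPf ba) /= ?nt ?nf.
have n y : ((u, v) == arc a b y = false) * ((v, u) == arc a b y = false).
  by case: y; split; apply/negbTE; rewrite // xpair_eqE andbC -xpair_eqE.
rewrite !n /=; case: ifP => // _.
by rewrite /add_arc -xpair_eqE -surjective_pairing n orbF.
Qed.

Let kappa O O' := connect (conflict O O') b a.

Lemma sep_add_oriented : {in setX (orientations e) [set: bool] &, forall p q,
  sep (add_oriented a b p) (add_oriented a b q) = edge_rel (@sep T) kappa p q}.
Proof.
move=> [O x] [O' x']; rewrite !in_setX !in_setT !andbT /= => tO tO'.
rewrite /sep (eq_acyclic (conflict_add_oriented x x' tO tO')) /edge_rel /= -/(sep O O').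
case: x; case: x' => //=; rewrite ?andbT //.
- by rewrite acyclic_add_arc.
- by rewrite acyclic_add_arc connect_conflictC.
Qed.

Lemma connect_add_oriented : {in setX (orientations e) [set: bool] &, forall p q,
  connect (conflict (add_oriented a b p) (add_oriented a b q)) b a = edge_conn kappa p q}.
Proof.
move=> [O x] [O' x']; rewrite !in_setX !in_setT !andbT /= => tO tO'.
rewrite (eq_connect (conflict_add_oriented x x' tO tO')) /edge_conn /= /kappa.
case: x; case: x' => //=; rewrite ?orbF // connect_add_arc ?connect0 ?orbT //.
by rewrite andbb orbb.
Qed.

Lemma equisized_add_edge n :
  equisized (setX (orientations e) [set: bool]) (edge_rel (@sep T) kappa) n <->
  equisized (orientations (add_edge e a b)) (@sep T) n.
Proof.
rewrite orientations_add_edge; apply: equisized_image; first exact: add_oriented_inj.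
exact: sep_add_oriented.
Qed.
End OneEdge.

Section PathAddition.
Variables (e : rel T) (a b v : T).
Hypotheses (e_sym : symmetric e) (ab : a != b) (av : a != v) (bv : b != v).
Hypothesis nv : forall x, ~~ e v x.

Let e1 := add_edge e v b.
(** Both Booleans being [true] means the directed path from [a] through [v] to [b], which matches
    the convention of [path_rel]. *)
Definition add_path (p : {set T * T} * (bool * bool)) :=
  add_oriented a v (add_oriented v b (p.1, p.2.2), p.2.1).

Let vb : v != b. Proof. by rewrite eq_sym. Qed.
Let nav : ~~ e1 a v.
Proof. by rewrite /e1 /add_edge e_sym (negPf (nv _)) (negPf ab) (negPf av). Qed.

Lemma connect_isolated O O' x : O \in orientations e -> O' \in orientations e ->
  (connect (conflict O O') v x = (x == v)) * (connect (conflict O O') x v = (x == v)).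
Proof.
have half O1 O2 : O1 \in orientations e -> connect (conflict O1 O2) v x = (x == v).
  move=> t1; apply/idP/eqP => [/connectP[[|z p] /=]|->]; rewrite ?connect0 //.
  by case/andP => /andP[/(orientation_edge t1)]; rewrite (negPf (nv _)).
by move=> tO tO'; rewrite half // connect_conflictC half.
Qed.

Lemma equisized_add_path n :
  equisized (setX (orientations e) [set: bool * bool])
    (path_rel (@sep T) (fun O O' => connect (conflict O O') b a)) n ->
  equisized (orientations (add_edge e1 a v)) (@sep T) n.
Proof.
have e1_sym : symmetric e1 by exact: add_edge_sym.
have e1O p : p \in setX (orientations e) [set: bool * bool] ->
    ((p.1, p.2.2) \in setX (orientations e) [set: bool]) *
    ((add_oriented v b (p.1, p.2.2), p.2.1) \in setX (orientations e1) [set: bool]) *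
    (add_oriented v b (p.1, p.2.2) \in orientations e1).
  move=> pC; have p1 : (p.1, p.2.2) \in setX (orientations e) [set: bool].
    by case: p pC => O [y z]; rewrite !in_setX !in_setT.
  have t1 : add_oriented v b (p.1, p.2.2) \in orientations e1.
    by rewrite /e1 orientations_add_edge // imset_f.
  by rewrite p1 in_setX in_setT /= t1.
have -> : orientations (add_edge e1 a v) = add_path @: setX (orientations e) [set: bool * bool].
  apply/setP => O; rewrite orientations_add_edge //; apply/imsetP/imsetP => [[[O1 y]]|[p pC ->]].
    rewrite in_setX in_setT /e1 orientations_add_edge // andbT => /imsetP[[O0 z] + ->] ->.
    by rewrite in_setX in_setT andbT => /= tO0; exists (O0, (y, z)); rewrite // in_setX tO0 in_setT.
  by exists (add_oriented v b (p.1, p.2.2), p.2.1); rewrite ?e1O.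
apply: (proj1 (equisized_image _ _ _)) => [[O [y z]] [O' [y' z']] pC qC|].
  move/(add_oriented_inj e1_sym av nav (e1O _ pC).1.2 (e1O _ qC).1.2) => [/= + ->].
  by case/(add_oriented_inj e_sym vb (nv _) (e1O _ pC).1.1 (e1O _ qC).1.1) => -> ->.
move=> [O [y z]] [O' [y' z']] pC qC; have [tO tO'] : O \in orientations e /\ O' \in orientations e.
  by move: pC qC; rewrite !in_setX => /andP[? _] /andP[].
have [t1 t1'] := ((e1O _ pC).2, (e1O _ qC).2); rewrite /= in t1 t1'.
rewrite /sep /add_path (eq_acyclic (conflict_add_oriented e1_sym av nav y y' t1 t1')) /path_rel /=.
have E := conflict_add_oriented e_sym vb (nv _) z z' tO tO'.
have ->: acyclic (if y == y' then conflict (add_oriented v b (O, z)) (add_oriented v b (O', z'))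
    else add_arc (conflict (add_oriented v b (O, z)) (add_oriented v b (O', z')))
          (arc a v y).1 (arc a v y).2) =
  acyclic (if y == y' then (if z == z' then conflict O O' else
            add_arc (conflict O O') (arc v b z).1 (arc v b z).2)
    else add_arc (if z == z' then conflict O O' else
            add_arc (conflict O O') (arc v b z).1 (arc v b z).2) (arc a v y).1 (arc a v y).2).
  by apply: eq_acyclic => x1 x2; case: ifP => _; rewrite /add_arc E.
(* As [v] is isolated in [e], only the cases where both new arcs form a directed path through [v]
   leave a condition beyond separation of [O] and [O']. *)
have iso := connect_isolated _ tO tO'.
rewrite -/(sep O O'); case: y y' z z' {t1 t1' E pC qC} => [] [] [] [] /=;
  rewrite ?acyclic_add_arc ?connect_add_arc ?iso ?connect0 ?eqxx ?(negPf av) ?(negPf bv)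
    ?[v == b]eq_sym ?[v == a]eq_sym ?(negPf av) ?(negPf bv) ?andbT ?andbF ?orbF //=.
by rewrite connect_conflictC.
Qed.
End PathAddition.
End EdgeAddition.

(** * Outerplanar graphs *)

Section Contraction.
Variables (T : finType) (e : rel T).
Hypothesis e_sym : symmetric e.

Lemma has_minor_subrel (e' : rel T) (U : finType) (h : rel U) :
  subrel e' e -> has_minor e' h -> has_minor e h.
Proof.
move=> e'e [f [f0 fd fc fa]]; exists f; split=> // [u x y xu yu|u v /fa[x [y [xu yv /e'e exy]]]].
  apply: connect_sub (fc _ _ _ xu yu) => a b /and3P[/e'e eab au bu].
  by apply: connect1; rewrite /induced eab au.
by exists x, y.
Qed.

(** Put [v] into the branch set containing [a], if there is one: the path from [a] through [v] to
    [b] then replaces the edge [ab], both inside a branch set and between two. No branch set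
    contained [v] before, because [v] is isolated in the smaller graph and every vertex of [h] has a
    neighbour. *)
Lemma has_minor_contract (v a b : T) (U : finType) (h : rel U) : symmetric h ->
  (forall u, exists w, h u w) -> a != v -> b != v -> e v a -> e v b ->
  has_minor (add_edge (delete_vertex e v) a b) h -> has_minor e h.
Proof.
move=> h_sym h_full av bv eva evb [f [f0 fd fc fa]]; set H := add_edge _ a b in fc fa.
have nHv x : ~~ H v x.
  by rewrite /H /add_edge /delete_vertex eqxx !andbF [v == a]eq_sym [v == b]eq_sym (negPf av) (negPf bv).
have vf u : v \notin f u.
  apply/negP => vu; have [w /fa[x [y [xu yw Hxy]]]] := h_full u.
  have /connectP[[|z p] /=] := fc _ _ _ vu xu; first by move=> _ xv; rewrite xv (negPf (nHv _)) in Hxy.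
  by case/andP => /andP[]; rewrite (negPf (nHv _)).
pose f' u := [set z | (z \in f u) || (z == v) && (a \in f u)].
have ff' u z : z \in f u -> z \in f' u by rewrite inE => ->.
have vf' u : a \in f u -> v \in f' u by rewrite inE eqxx => ->; rewrite orbT.
have He x y : H x y -> [\/ e x y, x = a /\ y = b | x = b /\ y = a].
  case/or3P => [/and3P[exy _ _]|/andP[/eqP-> /eqP->]|/andP[/eqP-> /eqP->]].
  - by constructor 1.
  - by constructor 2.
  - by constructor 3.
have isym u : connect_sym (induced e (f' u)) by apply: sym_connect_sym; exact: induced_sym.
exists f'; split.
- by move=> u; have /set0Pn[z zu] := f0 u; apply/set0Pn; exists z; exact: ff'.
- move=> u w uw; have /pred0P d := fd _ _ uw; apply/pred0P => z; rewrite /= !inE.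
  have [zv|zv] /= := eqVneq z v; last by rewrite !orbF; exact: d.
  by rewrite zv !(negPf (vf _)) /=; exact: d.
- move=> u.
  have base x y : x \in f u -> y \in f u -> connect (induced e (f' u)) x y.
    move=> xu yu; apply: connect_sub (fc _ _ _ xu yu) => {yu} c d /and3P[/He + cu du].
    case=> [ecd|[cE dE]|[cE dE]]; first by apply: connect1; rewrite /induced ecd !ff'.
      rewrite cE dE in cu du *; apply: (@connect_trans _ _ v); apply: connect1;
      by rewrite /induced ?evb ?[e a v]e_sym ?eva ?vf' ?ff'.
    rewrite cE dE in cu du *; apply: (@connect_trans _ _ v); apply: connect1;
    by rewrite /induced ?eva ?[e b v]e_sym ?evb ?vf' ?ff'.
  have toa x : x \in f' u -> exists2 x', x' \in f u & connect (induced e (f' u)) x x'.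
    rewrite inE => /orP[xu|/andP[/eqP-> au]]; first by exists x.
    by exists a => //; apply: connect1; rewrite /induced eva vf' ?ff'.
  move=> x y /toa[x' xu' xx'] /toa[y' yu' yy']; apply: connect_trans xx' _.
  by apply: connect_trans (base _ _ xu' yu') _; rewrite isym.
move=> u w huw; have [x [y [xu yw /He]]] := fa _ _ huw; case=> [exy|[xE yE]|[xE yE]].
- by exists x, y; split=> //; apply: ff'.
- by exists v, b; split=> //; [apply: vf'; rewrite -xE|apply: ff'; rewrite -yE].
- by exists b, v; split; [apply: ff'; rewrite -xE|apply: vf'; rewrite -yE|rewrite e_sym].
Qed.
End Contraction.

Lemma K4_sym : symmetric K4_rel. Proof. by move=> i j; rewrite /K4_rel eq_sym. Qed.
Lemma K4_full u : exists w, K4_rel u w.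
Proof.
by case: u => [[|u] Hu]; [exists (@Ordinal 4 1 isT)|exists (@Ordinal 4 0 isT)].
Qed.
Lemma K23_sym : symmetric K23_rel. Proof. by case=> ? [?|?]. Qed.
Lemma K23_full u : exists w, K23_rel u w.
Proof. by case: u => i; [exists (inr ord0)|exists (inl ord0)]. Qed.

(** A vertex of degree one doubles the size, as its edge lies on no cycle. For degree two with
    neighbours [a] and [b], the path count needs the size for the remaining graph plus one edge
    [ab]: this is either a smaller outerplanar graph or a graph with a doubled edge, counted by
    [card_parallel]. *)
Lemma equisized_orientations (T : finType) (e : rel T) :
  symmetric e -> irreflexive e -> ~ has_minor e K4_rel -> ~ has_minor e K23_rel ->
  exists n, equisized (orientations e) (@sep T) n.
Proof.
(* The induction counts non-isolated vertices, since a deleted vertex stays in the type [T]. *)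
pose m (e : rel T) := #|[set x | [exists y, e x y]]|.
have [k] := ubnP (m e); elim: k => // k IH in e * => /ltnSE mk e_sym e_irr nK4 nK23.
have [/existsP[x0 /existsP[y0 exy0]]|ne] := boolP [exists x, exists y, e x y]; last first.
  exists 1 => S [St _ Smax].
  have emp O : O \in orientations e -> O = set0.
    move=> tO; apply/setP => -[x y]; rewrite inE; apply/negP => /(orientation_edge tO) exy.
    by case/existsP: ne; exists x; apply/existsP; exists y.
  have t0 : set0 \in orientations e.
    apply/orientationsP; split=> [p|x y exy]; first by rewrite inE.
    by case/existsP: ne; exists x; apply/existsP; exists y.
  apply/eqP/cards1P; exists set0; apply/setP => O; rewrite in_set1; apply/idP/eqP.
    by move/(subsetP St)/emp.
  move=> ->; apply: Smax => // O2 /(subsetP St)/emp->.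
  by apply/acyclicP => x y; rewrite /conflict inE.
have [v /andP[v0 v2]] := low_degree_vertex e_sym e_irr nK4 exy0.
set K := delete_vertex e v.
have K_sym : symmetric K by move=> x y; rewrite /K /delete_vertex e_sym [(x != v) && _]andbC.
have K_sub : subrel K e by move=> x y /and3P[].
have nKv x : ~~ K v x by rewrite /K /delete_vertex eqxx andbF.
have lt_m (e' : rel T) : (forall x y, e' x y -> exists z, e x z) -> (forall x, ~~ e' v x) -> m e' < k.
  move=> e'e nv; apply: leq_trans mk; apply: proper_card; apply/properP; split.
    by apply/subsetP => x; rewrite !inE => /existsP[y /e'e[z exz]]; apply/existsP; exists z.
  exists v.
    by move: v0; rewrite card_gt0 inE => /set0Pn[z]; rewrite inE => evz; apply/existsP; exists z.
  by rewrite inE; apply/existsP => -[x]; apply/negP.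
have IHsub (e' : rel T) : symmetric e' -> subrel e' e -> (forall x, ~~ e' v x) ->
    exists n, equisized (orientations e') (@sep T) n.
  move=> e'_sym e'e nv; apply: IH => //.
  - by apply: lt_m => // x y /e'e exy; exists y.
  - by move=> x; apply/negP => /e'e; rewrite e_irr.
  - by move/(has_minor_subrel e'e).
  - by move/(has_minor_subrel e'e).
have nbrs : (exists a, forall z, e v z = (z == a)) \/
    (exists a b, a != b /\ forall z, e v z = (z == a) || (z == b)).
  move: v0 v2; case: (ltngtP #|[set z | e v z]| 1) => // [|/eqP/cards1P[a /setP aE] _ _]; last first.
    by left; exists a => z; have := aE z; rewrite !inE.
  move=> d1 _ d2; have /cards2P[a [b [nab /setP abE]]] : #|[set z | e v z]| == 2 by rewrite eqn_leq d2.
  by right; exists a, b; split=> // z; have := abE z; rewrite !inE.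
have [nK nKE] := IHsub K K_sym K_sub nKv.
case: nbrs => [[a evE]|[a [b [ab evE]]]].
  have av : a != v by apply/eqP => av; have := e_irr v; rewrite evE av eqxx.
  have eE : e =2 add_edge K a v.
    move=> x y; rewrite /add_edge /K /delete_vertex.
    have [->|xv] := eqVneq x v; first by rewrite evE andbF /= [v == a]eq_sym (negPf av).
    have [->|yv] := eqVneq y v; first by rewrite e_sym evE !andbF !andbT orbF.
    by rewrite !andbF andbT !orbF.
  rewrite (eq_orientations eE).
  have nKav : ~~ K a v by rewrite K_sym.
  exists (nK + nK); apply/equisized_add_edge => // S [SC Ss Smax].
  (* Both directions of the pendant edge are present over every projected orientation. *)
  have memS o x : ((o, x) \in S) = (o \in fst @: S).
    apply/idP/imsetP => [oS|[[o' x'] oS /= ->]]; first by exists (o, x).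
    have /(subsetP SC) := oS; rewrite in_setX => /andP[/= oC _].
    apply: Smax => [|[o2 x2] o2S]; first by rewrite in_setX oC in_setT.
    have /(subsetP SC) := o2S; rewrite in_setX => /andP[/= o2C _].
    have /and3P[/= so _ _] := Ss _ _ oS o2S; rewrite /edge_rel /= so /=.
    by rewrite !(connect_isolated nKv) // (negPf av) !implybT.
  rewrite card_pair_bool -(nKE (fst @: S)); last first.
    split.
    - by apply/subsetP => o; rewrite -(memS _ true) => /(subsetP SC); rewrite in_setX => /andP[].
    - move=> o o'; rewrite -!(memS _ true) => oS oS'.
      by have /and3P[] := Ss _ _ oS oS'.
    move=> o oC os; rewrite -(memS _ true); apply: Smax; first by rewrite in_setX oC in_setT.
    move=> [o' x'] oS'; rewrite /edge_rel /= os; last by rewrite -(memS _ x').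
    have /(subsetP SC) := oS'; rewrite in_setX => /andP[/= oC' _].
    by rewrite !(connect_isolated nKv) // (negPf av) !implybT.
  rewrite -sum1_card [in RHS]big_mkcond -big_split; apply: eq_bigr => o _ /=.
  by rewrite !memS; case: (o \in _).
have eva : e v a by rewrite evE eqxx.
have evb : e v b by rewrite evE eqxx orbT.
have av : a != v by apply/eqP => av; rewrite av e_irr in eva.
have bv : b != v by apply/eqP => bv; rewrite bv e_irr in evb.
have [va vb] : v != a /\ v != b by rewrite ![v == _]eq_sym.
have eE : e =2 add_edge (add_edge K v b) a v.
  move=> x y; rewrite /add_edge /K /delete_vertex.
  have [->|xv] := eqVneq x v.
    by rewrite evE andbF /= (negPf va) (negPf vb) /= !orbF orbC.
  have [->|yv] := eqVneq y v; first by rewrite e_sym evE /= !andbF !andbT /= !orbF orbC.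
  by rewrite !andbF andbT !orbF.
have k_tr (e' : rel T) : symmetric e' -> subrel e' e -> (forall x, ~~ e' v x) ->
    transitive_conn (@sep T) (fun O O' => connect (conflict O O') b a) (orientations e').
  by move=> e'_sym e'e nv; apply: (conflict_transitive e_sym e'_sym e'e nK23 nv).
rewrite (eq_orientations eE).
have [eab|neab] := boolP (e a b); last first.
  have nKab : ~~ K a b by apply: contra neab => /K_sub.
  have [nH nHE] : exists n, equisized (orientations (add_edge K a b)) (@sep T) n.
    apply: IH.
    - apply: lt_m => [x y|x].
        case/or3P => [/K_sub exy|/andP[/eqP-> _]|/andP[/eqP-> _]]; first by exists y.
          by exists v; rewrite e_sym.
        by exists v; rewrite e_sym.
      by rewrite /add_edge (negPf (nKv x)) (negPf va) (negPf vb).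
    - exact: add_edge_sym.
    - move=> x; rewrite /add_edge; apply/or3P => -[/K_sub||]; first by rewrite e_irr.
        by case/andP => /eqP-> ; rewrite (negPf ab).
      by case/andP => /eqP->; rewrite eq_sym (negPf ab).
    - move/(has_minor_contract e_sym K4_sym K4_full av bv eva evb); exact: nK4.
    - move/(has_minor_contract e_sym K23_sym K23_full av bv eva evb); exact: nK23.
  exists (nK + nK + nH); apply: equisized_add_path => //.
  apply: equisized_path => //; first exact: k_tr.
  exact/equisized_add_edge.
(* Here [ab] already belongs to [K], so [K] with one more edge is [L] with two parallel ones. *)
pose L := delete_edge K a b.
have L_sym : symmetric L.
  move=> x y; rewrite /L /delete_edge K_sym.
  by case: (K y x); case: (x == a); case: (y == b); case: (x == b); case: (y == a).
have L_sub : subrel L e by move=> x y /andP[/andP[/K_sub]].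
have nLv x : ~~ L v x by rewrite /L /delete_edge (negPf (nKv x)).
have [nL nLE] := IHsub L L_sym L_sub nLv.
have nLab : ~~ L a b by rewrite /L /delete_edge !eqxx andbF.
have KE : K =2 add_edge L a b.
  have Kab : K a b by rewrite /K /delete_vertex eab av.
  move=> x y; rewrite /add_edge /L /delete_edge.
  have [/andP[/eqP-> /eqP->]|n1] := boolP ((x == a) && (y == b)); first by rewrite Kab orbT.
  have [/andP[/eqP-> /eqP->]|n2] := boolP ((x == b) && (y == a)); first by rewrite K_sym Kab !orbT.
  by rewrite !andbT !orbF.
pose kap O O' := connect (@conflict T O O') b a.
have nKE' : equisized (setX (orientations L) [set: bool]) (edge_rel (@sep T) kap) nK.
  by apply/equisized_add_edge; rewrite // -(eq_orientations KE).
exists (nK + nK + (nK + nK - nL)); apply: equisized_add_path => //.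
apply: equisized_path => //; first exact: k_tr.
pose g (p : {set T * T} * bool * bool) := (add_oriented a b p.1, p.2).
have -> : setX (orientations K) [set: bool] =
    g @: setX (setX (orientations L) [set: bool]) [set: bool].
  rewrite (eq_orientations KE) orientations_add_edge //.
  apply/setP => -[O y]; apply/idP/imsetP => [|[[p z] + [-> ->]]].
    rewrite in_setX andbC => /andP[_ /imsetP[p pL ->]].
    by exists (p, y); rewrite // in_setX pL in_setT.
  by rewrite !(in_setX, in_setT) !andbT => pL; rewrite imset_f.
apply: (proj1 (@equisized_image _ _ g _ (edge_rel (edge_rel (@sep T) kap) (edge_conn kap)) _ _ _ _)).
- move=> [p y] [q z]; rewrite !in_setX => /andP[pL _] /andP[qL _] [pq ->].
  by rewrite (add_oriented_inj L_sym ab nLab pL qL pq).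
- move=> [p y] [q z]; rewrite !in_setX => /andP[pL _] /andP[qL _].
  rewrite /g [LHS]/edge_rel /= (sep_add_oriented L_sym ab nLab pL qL).
  by rewrite !(connect_add_oriented L_sym ab nLab).
move=> S maxS; rewrite -(card_parallel (k_tr _ L_sym L_sub nLv) nLE nKE' maxS).
by rewrite addnK.
Qed.

(** * Forests and circuits of the oriented matroid *)

Section ForestCount.
Import Order.TTheory GRing.Theory Num.Theory.
Variables (T : finType) (e : rel T) (D : {set T * T}).
Hypotheses (e_sym : symmetric e) (e_irr : irreflexive e) (tD : D \in orientations e).

Definition underlying (A : {set T * T}) : {set {set T}} := [set [set p.1; p.2] | p in A].

Lemma eq_set2 (a b x y : T) : [set a; b] = [set x; y] -> (a, b) = (x, y) \/ (a, b) = (y, x).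
Proof.
move=> E; have := set21 a b; have := set22 a b; have := set21 x y; have := set22 x y.
rewrite -{1 2}E {3 4}E => yE xE /set2P[bE|bE] /set2P[aE|aE]; rewrite bE aE in yE xE *.
- by left; congr (_, _); case/set2P: yE.
- by right.
- by left.
- by right; congr (_, _); case/set2P: xE.
Qed.

Lemma mem_underlying (A : {set T * T}) x y : ([set x; y] \in underlying A) = undirected A x y.
Proof.
apply/imsetP/orP => [[[a b] abA /eq_set2[[-> ->]|[-> ->]]]|[]]; [by left|by right|..] => xyA.
  by exists (x, y).
by exists (y, x); rewrite // setUC.
Qed.

Lemma underlying_inj : {in powerset D &, injective underlying}.
Proof.
suff sub (A B : {set T * T}) : A \subset D -> B \subset D -> underlying A = underlying B -> A \subset B.
  move=> A B; rewrite !inE => AD BD AB; apply/eqP.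
  by rewrite eqEsubset (sub _ _ AD BD AB) (sub _ _ BD AD (esym AB)).
move=> /subsetP AD /subsetP BD AB; apply/subsetP => -[x y] xyA.
have : [set x; y] \in underlying B by rewrite -AB mem_underlying /undirected xyA.
rewrite mem_underlying => /orP[//|/BD].
by rewrite (negPf (orientation_asym tD (AD _ xyA))).
Qed.

Lemma path_sources (r : rel T) (P : pred T) z q x :
  path r z (rcons q x) -> all P (z :: q) -> path (fun u w => r u w && P u) z (rcons q x).
Proof.
elim: q z => [|w q IH] z /=; first by move=> /andP[-> _] /andP[-> _].
by move=> /andP[-> wq] /andP[-> Pq] /=; apply: IH.
Qed.

Lemma undirectedD1 (A : {set T * T}) x y u w : (u, w) != (x, y) -> (w, u) != (x, y) ->
  undirected A u w -> undirected (A :\ (x, y)) u w.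
Proof. by rewrite /undirected !in_setD1 => -> ->. Qed.

(** An arc that is no bridge closes a cycle with at least three vertices, because [A] lies in an
    orientation and so has no second arc between the same ends. *)
Lemma is_forest_acyclicP (A : {set T * T}) : A \subset D ->
  reflect (~ exists c, [&& uniq c, 2 < size c & cycle (undirected A) c]) (is_forest A).
Proof.
move=> /subsetP AD; apply: (iffP idP) => [/is_forestP fA [[|x [|y [|z q]]]]|nc].
- by [].
- by case/and3P.
- by case/and3P.
- case/and3P => /= /and4P[+ + zq _] _ /and3P[xy yz qx].
  rewrite !inE !negb_or => /and3P[nxy nxz xq] /andP[nyz yq].
  have all_off : all (fun u => (u != x) && (u != y)) (z :: q).
    by apply/allP => u; rewrite inE => /predU1P[->|uq];
      [rewrite ![z == _]eq_sym nxz nyz|apply/andP; split; apply: contraTneq uq => ->].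
  have cyx a b : ((a == x) && (b == y)) || ((a == y) && (b == x)) ->
      connect (undirected (A :\ (a, b))) y x.
    move=> ab; apply: (@connect_trans _ _ z).
      apply: connect1; apply: undirectedD1 yz; rewrite xpair_eqE; apply: contraTN ab;
      case/andP => /eqP<- /eqP<-; rewrite ?[y == x]eq_sym ?[z == x]eq_sym ?[z == y]eq_sym;
      by rewrite ?(negPf nxy) ?(negPf nxz) ?(negPf nyz) ?andbF.
    apply/connectP; exists (rcons q x); last by rewrite last_rcons.
    apply: sub_path (path_sources qx all_off) => u w /andP[uw /andP[ux uy]].
    apply: undirectedD1 uw; rewrite xpair_eqE; apply: contraTN ab;
    case/andP => /eqP<- /eqP<-; by rewrite ?(negPf ux) ?(negPf uy) ?andbF.
  case/orP: xy => [/[dup] xyA /fA|/[dup] yxA /fA] /= /negP[].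
    by rewrite connect_undirected_sym cyx ?eqxx.
  by rewrite cyx ?eqxx ?orbT.
apply/is_forestP => -[x y] xyA /=; apply/negP => /connectP[s0 xs0 ys0].
case/shortenP: xs0 ys0 => s xs us _ ys; apply: nc; exists (x :: s).
have sub : subrel (undirected (A :\ (x, y))) (undirected A).
  by move=> u w; rewrite /undirected !in_setD1 => /orP[] /andP[_ ->]; rewrite ?orbT.
have exy := orientation_edge tD (AD _ xyA).
rewrite us /= rcons_path (sub_path sub xs) -ys /undirected xyA orbT andbT /=.
case: s xs us ys => [_ _ xy|z [|w s]] //=; first by rewrite xy e_irr in exy.
rewrite andbT => + _ zy; rewrite -zy /undirected !in_setD1 eqxx /= => /andP[_ /AD].
by rewrite (negPf (orientation_asym tD (AD _ xyA))).
Qed.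

Lemma forest_underlying (F : {set {set T}}) : forest e F <-> F \in underlying @: forests D.
Proof.
have cycE (r r' : rel T) c : r =2 r' -> cycle r c = cycle r' c.
  by move=> rr'; case: c => //= x p; apply: eq_path.
split=> [[/subsetP FE acF]|/imsetP[A]].
  pose A := [set p in D | [set p.1; p.2] \in F].
  have AD : A \subset D by apply/subsetP => p; rewrite inE => /andP[].
  have FA : F = underlying A.
    apply/setP => E; apply/idP/imsetP => [EF|[p]]; last by rewrite inE => /andP[_ ?] ->.
    have := FE _ EF; rewrite inE => /existsP[x /existsP[y /andP[exy /eqP Exy]]].
    have [xyD|xyD] := boolP ((x, y) \in D); first by exists (x, y); rewrite ?inE ?xyD -?Exy.
    by exists (y, x); rewrite ?inE /= 1?(orientation_rev tD) ?xyD //= setUC -?Exy.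
  apply/imsetP; exists A => //; rewrite !inE AD /=; apply/(is_forest_acyclicP AD) => -[c ac].
  apply: acF; exists c; rewrite (cycE _ (undirected A)) // => x y.
  by rewrite FA mem_underlying.
rewrite !inE => /andP[AD /(is_forest_acyclicP AD) acA] ->; split.
  apply/subsetP => _ /imsetP[[x y] xyA ->]; rewrite inE; apply/existsP; exists x; apply/existsP.
  by exists y; rewrite (orientation_edge tD (subsetP AD _ xyA)) eqxx.
case=> c ac; apply: acA; exists c; rewrite (cycE _ (fun x y => [set x; y] \in underlying A)) //.
by move=> x y; rewrite mem_underlying.
Qed.

Lemma is_num_forestsP n : is_num_forests e n <-> n = #|forests D|.
Proof.
have <- : #|underlying @: forests D| = #|forests D|.
  rewrite card_in_imset // => A B; rewrite !inE => /andP[AD _] /andP[BD _].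
  by apply: underlying_inj; rewrite inE.
split=> [[s [us <- sP]]|->].
  rewrite -(card_uniqP us); apply: eq_card => F.
  by apply/idP/idP => [/sP/forest_underlying|/forest_underlying/sP].
exists (enum (underlying @: forests D)); rewrite enum_uniq -cardE; split=> // F.
by rewrite mem_enum; split=> /forest_underlying.
Qed.
End ForestCount.

Section Circuits.
Import Order.TTheory GRing.Theory Num.Theory.
Variables (T : finType) (e : rel T) (D : {set T * T}).
Hypotheses (e_sym : symmetric e) (e_irr : irreflexive e) (tD : D \in orientations e).
Variable R : realFieldType.
Implicit Types (lam mu : T * T -> R) (I J : {set T * T}).
Local Open Scope ring_scope.

Definition flow lam x y := lam (x, y) - lam (y, x).

(** The coordinate of the linear combination at [v] is the net outflow at [v], so linear
    dependencies are circulations. *)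
Lemma lin_dependencyP lam : lin_dependency D lam <->
  (forall a, a \notin D -> lam a = 0) /\ forall v, \sum_y flow lam v y = 0.
Proof.
suff E : (forall a, a \notin D -> lam a = 0) -> forall v,
    \sum_(a in D) lam a * ((a.1 == v)%:R - (a.2 == v)%:R) = \sum_y flow lam v y.
  by split=> -[l0 l1]; split=> // v; [rewrite -E | rewrite E].
move=> l0 v.
have -> : \sum_(a in D) lam a * ((a.1 == v)%:R - (a.2 == v)%:R) =
          \sum_a lam a * ((a.1 == v)%:R - (a.2 == v)%:R).
  by rewrite big_mkcond; apply: eq_bigr => a _; case: ifP => // /negbT/l0->; rewrite mul0r.
rewrite (eq_bigr (fun a => lam (a.1, a.2) * (a.1 == v)%:R - lam (a.1, a.2) * (a.2 == v)%:R)); last first.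
  by case=> x y _; rewrite mulrBr.
rewrite !sumrB; congr (_ - _).
  rewrite -(pair_big xpredT xpredT (fun x y => lam (x, y) * (x == v)%:R)) /= (bigD1 v) //=.
  rewrite [X in _ + X]big1 ?addr0 => [|x /negPf xv]; last by rewrite big1 // => y _; rewrite xv mulr0.
  by apply: eq_bigr => y _; rewrite eqxx mulr1.
rewrite -(pair_big xpredT xpredT (fun x y => lam (x, y) * (y == v)%:R)) /=.
apply: eq_bigr => x _; rewrite (bigD1 v) //= eqxx mulr1 big1 ?addr0 // => y /negPf->.
by rewrite mulr0.
Qed.

Lemma no_sink_cyclic (r : rel T) x y : r x y -> (forall u v, r u v -> exists w, r v w) -> ~~ acyclic r.
Proof.
move=> rxy out; apply/negP => /acyclicP ac.
have [n] := ubnP #|connect r y|; elim: n x y rxy => // n IH x y rxy /ltnSE yn.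
have [z ryz] := out _ _ rxy; apply: (IH _ _ ryz); apply: leq_trans yn; apply: proper_card.
apply/properP; split; first by apply/subsetP => w; apply: connect_trans; exact: connect1.
by exists y; [exact: connect0|exact: ac].
Qed.

Lemma flowN lam x y : flow lam y x = - flow lam x y.
Proof. by rewrite /flow opprB. Qed.

Lemma flow_out lam x y : (forall v, \sum_y flow lam v y = 0) -> 0 < flow lam x y ->
  exists z, 0 < flow lam y z.
Proof.
move=> cons xy; apply/existsP; apply: contraT => /existsPn no.
have le z : 0 <= - flow lam y z by rewrite oppr_ge0 leNgt no.
have /eqP := cons y; rewrite -oppr_eq0 -sumrN psumr_eq0 => [|z _]; last exact: le.
by move=> /allP/(_ x); rewrite mem_index_enum -flowN => /(_ isT); rewrite gt_eqF.
Qed.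

(** The arcs of positive flow have no sink by conservation, hence they contain a directed cycle. The
    sign conditions make all of them conflict arcs: those with negative coefficient are traversed
    backwards. *)
Lemma circuit_conflict I J lam : I \subset D -> J \subset D ->
  lin_dependency D lam -> dep_support D lam != set0 ->
  [set a in D | 0 < lam a] \subset I :\: J -> [set a in D | lam a < 0] \subset J :\: I ->
  ~~ sep (reorient D I) (reorient D J).
Proof.
move=> ID JD /lin_dependencyP[l0 cons] /set0Pn[[x y]] + sp sm.
rewrite inE => /andP[xyD xy0].
have pos u v : 0 < flow lam u v -> conflict (reorient D I) (reorient D J) u v.
  move=> uv; rewrite /conflict !mem_reorient.
  have [uvD|uvD] := boolP ((u, v) \in D).
    have vu0 : lam (v, u) = 0 by apply: l0; apply: orientation_asym tD uvD.
    have /(subsetP sp) : (u, v) \in [set a in D | 0 < lam a].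
      by move: uv; rewrite inE uvD /flow vu0 subr0.
    by rewrite !in_setD => /andP[-> ->]; rewrite uvD orbT.
  have [vuD|vuD] := boolP ((v, u) \in D); last by rewrite /flow !l0 ?subrr ?ltxx in uv.
  have /(subsetP sm) : (v, u) \in [set a in D | lam a < 0].
    by move: uv; rewrite inE vuD /flow (l0 _ uvD) sub0r oppr_gt0.
  by rewrite !in_setD => /andP[-> ->]; rewrite vuD orbT.
have yx0 : lam (y, x) = 0 by apply: l0; apply: orientation_asym tD xyD.
suff [u [v uv]] : exists u v, 0 < flow lam u v.
  apply: contra (no_sink_cyclic (r := fun u v => 0 < flow lam u v) uv _).
    exact: sub_acyclic pos.
  by move=> a b; apply: flow_out.
move: xy0; rewrite neq_lt => /orP[lt|gt]; [exists y, x|exists x, y]; rewrite /flow yx0.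
  by rewrite sub0r oppr_gt0.
by rewrite subr0.
Qed.

Section CycleDependency.
Variables (I J : {set T * T}) (c : seq T).
Hypotheses (ID : I \subset D) (JD : J \subset D) (c_uniq : uniq c) (c_size : (2 < size c)%N).
Hypothesis c_cycle : cycle (conflict (reorient D I) (reorient D J)) c.

Let on_cycle x y := (x \in c) && (y == next c x).
Let lam (a : T * T) : R :=
  if a \in D then (on_cycle a.1 a.2)%:R - (on_cycle a.2 a.1)%:R else 0.

Let on_cycle_conflict x y : on_cycle x y -> conflict (reorient D I) (reorient D J) x y.
Proof. by case/andP => xc /eqP->; apply: next_cycle. Qed.

Let tI : reorient D I \in orientations e. Proof. exact: reorient_orientation. Qed.

Let on_cycle_edge x y : on_cycle x y -> e x y.
Proof. by move/on_cycle_conflict => /andP[/(orientation_edge tI)]. Qed.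

Let on_cycle_asym x y : on_cycle x y -> on_cycle y x = false.
Proof.
move=> xy; apply/negP => /on_cycle_conflict; apply/negP.
apply: (conflict_asym tI); exact: on_cycle_conflict.
Qed.

Let on_cycle_prev x y : on_cycle x y = (y \in c) && (x == prev c y).
Proof.
apply/andP/andP => -[zc /eqP->]; rewrite ?mem_next ?mem_prev zc.
  by rewrite prev_next.
by rewrite next_prev.
Qed.

Let flow_lam x y : flow lam x y = (on_cycle x y)%:R - (on_cycle y x)%:R.
Proof.
rewrite /flow /lam /=; have [exy|nexy] := boolP (e x y).
  by rewrite (orientation_rev tD exy); case: ((x, y) \in D); rewrite /= ?subr0 ?sub0r ?opprB.
have nyx : ~~ e y x by rewrite e_sym.
have out u v : ~~ e u v -> (on_cycle u v = false) * (((u, v) \in D) = false).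
  by move=> nuv; split; apply: contraNF nuv; [exact: on_cycle_edge|exact: orientation_edge].
by rewrite !(out x y) // !(out y x).
Qed.

Let lam_dependency : lin_dependency D lam.
Proof.
apply/lin_dependencyP; split=> [a /negPf aD|v]; first by rewrite /lam aD.
under eq_bigr => y _ do rewrite flow_lam.
rewrite sumrB; apply/eqP; rewrite subr_eq0; apply/eqP.
transitivity ((v \in c)%:R : R).
  rewrite (bigD1 (next c v)) //= /on_cycle eqxx andbT big1 ?addr0 // => y /negPf->.
  by rewrite andbF.
rewrite (bigD1 (prev c v)) //= [in RHS]on_cycle_prev eqxx andbT big1 ?addr0 // => y yv.
by rewrite on_cycle_prev (negPf yv) andbF.
Qed.

Let lam_neq0 a : (a \in dep_support D lam) = (a \in D) && (on_cycle a.1 a.2 || on_cycle a.2 a.1).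
Proof.
rewrite inE /lam; case: ifP => //= _.
have [xy|xy] /= := boolP (on_cycle a.1 a.2); first by rewrite on_cycle_asym // subr0 oner_eq0.
by case: (on_cycle _ _); rewrite ?sub0r ?oppr_eq0 ?oner_eq0 ?subrr ?eqxx.
Qed.

(** The flow of [mu] vanishes off the cycle, so conservation equates its values on consecutive arcs
    of [c]. It is therefore constant along [c], and missing one arc makes it zero. *)
Let lam_minimal mu : lin_dependency D mu -> dep_support D mu != set0 ->
  ~ (dep_support D mu \proper dep_support D lam).
Proof.
move=> /lin_dependencyP[m0 cons] /set0Pn[a0 a0mu] /properP[/subsetP sub [[x y] xyl xym]].
have mu_flow u v : (u, v) \in D -> mu (u, v) = flow mu u v.
  by move=> uvD; rewrite /flow (m0 (v, u)) ?subr0 // (orientation_asym tD uvD).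
have off u v : ~~ on_cycle u v -> ~~ on_cycle v u -> flow mu u v = 0.
  move=> nuv nvu.
  have z p : ~~ on_cycle p.1 p.2 -> ~~ on_cycle p.2 p.1 -> mu p = 0.
    move=> n1 n2; have [pD|/m0//] := boolP (p \in D).
    apply/eqP; apply: contraT => pm; have /sub : p \in dep_support D mu by rewrite inE pD.
    by rewrite lam_neq0 (negPf n1) (negPf n2) andbF.
  by rewrite /flow !z ?subrr.
pose phi v := flow mu v (next c v).
have phi_next v : v \in c -> phi (next c v) = phi v.
  move=> vc; set w := next c v; have wc : w \in c by rewrite mem_next.
  have vw : on_cycle v w by rewrite /on_cycle vc eqxx.
  have ww : on_cycle w (next c w) by rewrite /on_cycle wc eqxx.
  have ne : v != next c w.
    by apply: contraTneq (ww) => <-; rewrite on_cycle_asym.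
  have := cons w; rewrite (bigD1 (next c w)) //= (bigD1 v) //= big1 ?addr0; last first.
    move=> u /andP[uw uv]; apply: off; first by rewrite /on_cycle (negPf uw) andbF.
    by rewrite on_cycle_prev /w prev_next // (negPf uv) andbF.
  by rewrite (flowN _ v w) => /eqP; rewrite subr_eq0 => /eqP.
have phi_const u v : u \in c -> v \in c -> phi u = phi v.
  move=> uc vc; have : fconnect (next c) u v by rewrite (fconnect_cycle (cycle_next c_uniq)).
  case/connectP => p; elim: p u uc => [u _ _ ->//|w p IH u uc /= /andP[/eqP<- wp] lv].
  by rewrite -phi_next // (IH _ _ wp lv) // mem_next.
have [z zc phiz] : exists2 z, z \in c & phi z = 0.
  move: xyl xym; rewrite lam_neq0 inE => /andP[xyD +]; rewrite xyD /= negbK => + /eqP.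
  rewrite mu_flow // => /orP[] /andP[zc /eqP yE] f0; [exists x|exists y] => //.
    by rewrite /phi -yE.
  by rewrite /phi -yE flowN f0 oppr0.
have phi0 u : u \in c -> phi u = 0 by move=> uc; rewrite (phi_const _ _ uc zc).
case: a0 a0mu => u v /[dup] /sub; rewrite lam_neq0 inE => /andP[uvD uv]; rewrite uvD /=.
rewrite mu_flow //; case/orP: uv => /andP[zc' /eqP /= E]; apply/negP; rewrite negbK.
  by rewrite E -/(phi u) phi0.
by rewrite flowN E -/(phi v) phi0 ?oppr0.
Qed.

Lemma cycle_circuit : exists Xp Xm, [/\ om_circuit R D Xp Xm, Xp \subset I :\: J & Xm \subset J :\: I].
Proof.
exists [set a in D | 0 < lam a], [set a in D | lam a < 0]; split.
- exists lam; split=> //; split=> //.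
  have [x xc] : exists x, x \in c by case: (c) c_size => // x p _; exists x; rewrite inE eqxx.
  have xy : on_cycle x (next c x) by rewrite /on_cycle xc eqxx.
  apply/set0Pn; have [xyD|xyD] := boolP ((x, next c x) \in D).
    by exists (x, next c x); rewrite lam_neq0 xyD xy.
  exists (next c x, x); rewrite lam_neq0 (orientation_rev tD) ?xyD /= ?xy ?orbT //.
  exact: on_cycle_edge.
- apply/subsetP => -[x y]; rewrite inE => /andP[xyD]; rewrite /lam xyD /=.
  have [xy _|xy] := boolP (on_cycle x y); last by rewrite sub0r oppr_gt0 ltNge ler0n.
  have := on_cycle_conflict xy; rewrite /conflict !mem_reorient !in_setD.
  rewrite (negPf (orientation_asym tD xyD)) xyD !andbF orbF => /andP[-> /orP[/(subsetP JD)|]].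
    by rewrite (negPf (orientation_asym tD xyD)).
  by rewrite !andbT.
apply/subsetP => -[x y]; rewrite inE => /andP[xyD]; rewrite /lam xyD /=.
have [yx _|yx] := boolP (on_cycle y x); last by rewrite subr0 ltNge ler0n.
have := on_cycle_conflict yx; rewrite /conflict !mem_reorient !in_setD.
rewrite (negPf (orientation_asym tD xyD)) xyD !andbF orbF => /andP[/orP[/(subsetP ID)|]].
  by rewrite (negPf (orientation_asym tD xyD)).
by rewrite andbT => -> ->.
Qed.
End CycleDependency.

Lemma M_separatedP I J : I \subset D -> J \subset D ->
  reflect (M_separated R D I J) (sep (reorient D I) (reorient D J)).
Proof.
move=> ID JD; have tI := reorient_orientation e_sym tD ID.
apply: (iffP idP) => [sIJ [Xp [Xm [[lam [[dl sl _] [-> ->]]] sp sm]]]|msep].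
  by have /negP[] := circuit_conflict ID JD dl sl sp sm.
apply: contraT; rewrite negb_forall => /existsP[x]; rewrite negb_forall => /existsP[y].
rewrite negb_imply negbK => /andP[xy yx].
have [c [uc sc cc]] := cycle_of_connect (conflict_irr e_irr _ tI) (conflict_asym tI) xy yx.
by case: msep; exact: cycle_circuit uc sc cc.
Qed.
End Circuits.

(** * Purity *)

Section Purity.
Import Order.TTheory GRing.Theory Num.Theory.
Variables (T : finType) (e : rel T).
Hypotheses (e_sym : symmetric e) (e_irr : irreflexive e).

Lemma orientation_exists : exists D, D \in orientations e.
Proof.
exists [set p | e p.1 p.2 && (enum_rank p.1 < enum_rank p.2)]; apply/orientationsP; split.
  by move=> p; rewrite inE => /andP[].
move=> x y exy; rewrite !inE /= [e y x]e_sym exy /=; case: ltngtP => // xy.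
by rewrite (enum_rank_inj (val_inj xy)) e_irr in exy.
Qed.

Lemma G_maximal_separatedP S :
  G_maximal_separated e S <-> maximal_family (orientations e) (@sep T) S.
Proof.
have collP S' : G_separated_collection e S' <->
    S' \subset orientations e /\ {in S' &, forall O O', sep O O'}.
  split=> [[tS sS]|[/subsetP tS sS]].
    have St : S' \subset orientations e by apply/subsetP => O /tS/orientationsP.
    by split=> // O O' OS O'S; apply/(sepP e_irr O' (subsetP St _ OS))/sS.
  split=> [O /tS/orientationsP//|O O' OS O'S].
  by apply/(sepP e_irr O' (tS _ OS))/sS.
split=> [[/collP[St Ss] Smax]|[St Ss Smax]]; split=> //; last 2 first.
- exact/collP.
- move=> O /orientationsP tO OS /collP[_ OSs]; case/negP: OS; apply: Smax => // O' O'S.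
  by apply: OSs; rewrite !inE ?eqxx ?O'S ?orbT.
move=> O tO Os; apply: contraT => /(Smax O (elimT (orientationsP _ _) tO))[].
apply/collP; split=> [|O1 O2]; first by rewrite subUset sub1set tO.
case/setU1P => [->|O1S] /setU1P[->|O2S]; [exact: (sep_refl tO)|exact: Os| |exact: Ss].
by rewrite sepC; apply: Os.
Qed.

Variable D : {set T * T}.
Hypothesis tD : D \in orientations e.

(** A maximal family containing [lex_family] has at least as many members as there are forests, and
    no separated family has more. *)
Lemma equisized_forests n : equisized (orientations e) (@sep T) n -> n = #|forests D|.
Proof.
move=> eqn; have Lt : lex_family e D \subset orientations e.
  by apply/subsetP => O; rewrite inE => /andP[].
have [S LS maxS] : exists2 S : {set {set T * T}}, lex_family e D \subset S &
    maximal_family (orientations e) (@sep T) S.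
  apply: extend_family => //; [|exact: sepC|exact: lex_family_sep].
  by move=> O tO; apply: (sep_refl tO).
rewrite -(eqn _ maxS); have [St Ss _] := maxS; apply/eqP.
rewrite eqn_leq (card_separated_le e_sym tD St Ss) -(card_lex_family e_sym e_irr tD).
exact: subset_leq_card.
Qed.

Lemma outerplanar_equisized : outerplanar e -> equisized (orientations e) (@sep T) #|forests D|.
Proof.
case=> nK4 nK23; have [n eqn] := equisized_orientations e_sym e_irr nK4 nK23.
by rewrite -(equisized_forests eqn).
Qed.

Lemma not_outerplanar_obstruction : has_minor e K4_rel \/ has_minor e K23_rel ->
  exists2 S, maximal_family (orientations e) (@sep T) S & #|S| < #|forests D|.
Proof.
suff sm : (exists2 S, maximal_family (orientations e) (@sep T) S & #|S| <> #|forests D|) ->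
    exists2 S, maximal_family (orientations e) (@sep T) S & #|S| < #|forests D|.
  by case=> [/(K4_obstruction e_sym e_irr tD)|/(K23_obstruction e_sym e_irr tD)]; apply: sm.
case=> S maxS /eqP ne; exists S => //; rewrite ltn_neqAle ne /=.
by have [St Ss _] := maxS; exact: (card_separated_le e_sym tD St Ss).
Qed.

Lemma pure_graph_outerplanar : pure_graph e <-> outerplanar e.
Proof.
split=> [pure|/outerplanar_equisized eqn S /G_maximal_separatedP/eqn cS]; last first.
  exact/(is_num_forestsP e_irr tD).
have no : ~ (has_minor e K4_rel \/ has_minor e K23_rel).
  case/not_outerplanar_obstruction => S /G_maximal_separatedP/pure.
  by move/(is_num_forestsP e_irr tD) => ->; rewrite ltnn.
by split=> hm; apply: no; [left|right].
Qed.

Section OrientedMatroidPurity.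
Variable R : realFieldType.

Lemma M_separated_collectionP S : M_separated_collection R D S <->
  S \subset powerset D /\ {in S &, forall I J, sep (reorient D I) (reorient D J)}.
Proof.
split=> [[SD Ss]|[/subsetP SD Ss]].
  split=> [|I J IS JS]; first by apply/subsetP => I /SD; rewrite inE.
  by apply/(M_separatedP e_sym e_irr tD R (SD _ IS) (SD _ JS))/Ss.
have {}SD I : I \in S -> I \subset D by move/SD; rewrite inE.
split=> // I J IS JS; apply/(M_separatedP e_sym e_irr tD R (SD _ IS) (SD _ JS)); exact: Ss.
Qed.

Lemma M_maximal_separatedP S : M_maximal_separated R D S <->
  maximal_family (powerset D) (fun I J => sep (reorient D I) (reorient D J)) S.
Proof.
split=> [[/M_separated_collectionP[SD Ss] Smax]|[SD Ss Smax]]; split=> //; last 2 first.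
- exact/M_separated_collectionP.
- move=> I ID IS /M_separated_collectionP[_ ISs]; case/negP: IS; apply: Smax => [|J JS].
    by rewrite inE.
  by apply: ISs; rewrite !inE ?eqxx ?JS ?orbT.
move=> I; rewrite inE => ID Is; apply: contraT => /(Smax I ID)[]; apply/M_separated_collectionP.
have tI := reorient_orientation e_sym tD ID.
split=> [|J1 J2]; first by rewrite subUset sub1set inE ID.
case/setU1P => [->|J1S] /setU1P[->|J2S]; [exact: (sep_refl tI)|exact: Is| |exact: Ss].
by rewrite sepC; apply: Is.
Qed.

Lemma reorient_inj : {in powerset D &, injective (reorient D)}.
Proof.
move=> I J; rewrite !inE => ID JD IJ.
by rewrite -(reorient_trace tD ID) IJ (reorient_trace tD JD).
Qed.

Lemma reorient_image : reorient D @: powerset D = orientations e.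
Proof.
apply/setP => O; apply/imsetP/idP => [[I] + ->|tO].
  by rewrite inE => ID; apply: reorient_orientation.
by exists (O :&: D); rewrite ?inE ?subsetIr // (trace_reorient e_sym tD tO).
Qed.

Lemma card_M_separated S : M_separated_collection R D S -> #|S| <= #|forests D|.
Proof.
move/M_separated_collectionP => [SD Ss].
have -> : #|S| = #|reorient D @: S|.
  by rewrite card_in_imset // => I J /(subsetP SD) ID /(subsetP SD) JD; apply: reorient_inj.
apply: (card_separated_le e_sym tD); first by rewrite -reorient_image imsetS.
by move=> _ _ /imsetP[I IS ->] /imsetP[J JS ->]; apply: Ss.
Qed.

Lemma om_pure_outerplanar : om_pure R D <-> outerplanar e.
Proof.
have transfer n := @equisized_image _ _ (reorient D) (powerset D)
  (fun I J => sep (reorient D I) (reorient D J)) (@sep T) reorient_inj (fun _ _ _ _ => erefl) n.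
rewrite reorient_image in transfer.
split=> [pure|/outerplanar_equisized/transfer eqn S S' /M_maximal_separatedP/eqn->]; last first.
  exact: card_M_separated.
have no : ~ (has_minor e K4_rel \/ has_minor e K23_rel).
  case/not_outerplanar_obstruction => S [St Ss Smax]; apply/negP; rewrite -leqNgt.
  have Lt : lex_family e D \subset orientations e.
    by apply/subsetP => O; rewrite inE => /andP[].
  have trace_coll (S' : {set {set T * T}}) : S' \subset orientations e ->
      {in S' &, forall O O', sep O O'} -> M_separated_collection R D [set O :&: D | O in S'].
    move=> St' Ss'; apply/M_separated_collectionP; split.
      by apply/subsetP => _ /imsetP[O _ ->]; rewrite inE subsetIr.
    move=> _ _ /imsetP[O OS ->] /imsetP[O' OS' ->].
    by rewrite !(trace_reorient e_sym tD) ?(subsetP St') // Ss'.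
  (* The traces of [lex_family] serve as the separated collection with which purity compares the
     traces of [S]. *)
  rewrite -(card_lex_family e_sym e_irr tD) -(card_traces tD Lt) -(card_traces tD St).
  apply: pure; last by apply: trace_coll => //; exact: lex_family_sep.
  have /M_separated_collectionP[tSD tSs] := trace_coll _ St Ss.
  apply/M_maximal_separatedP; split=> // I; rewrite inE => ID Is.
  apply/imsetP; exists (reorient D I); last by rewrite (reorient_trace tD ID).
  apply: Smax => [|O OS]; first exact: reorient_orientation.
  by rewrite -(trace_reorient e_sym tD (subsetP St _ OS)); apply: Is; apply/imsetP; exists O.
by split=> hm; apply: no; [left|right].
Qed.
End OrientedMatroidPurity.
End Purity.

Theorem theorem5p5 (T : finType) (e : rel T)
    (e_sym : symmetric e) (e_irr : irreflexive e) :
  (pure_graph e <-> outerplanar e) /\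
  (forall (R : realFieldType) (D : {set T * T}),
      total_orientation e D -> (om_pure R D <-> outerplanar e)).
Proof.
split=> [|R D /orientationsP tD]; last exact: om_pure_outerplanar.
by have [D tD] := orientation_exists e_sym e_irr; apply: (pure_graph_outerplanar e_sym e_irr tD).
Qed.
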